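(* Let $\mathbf{u}^0:\mathbb{R}^N\to\mathbb{R}^m$ be bounded and continuous. The function $\mathbf{v}(t,x):=(\mathcal{S}(t)\mathbf{u}^0)(x)$ is a (viscosity) subsolution of $$\partial_t u_i+H_i(x,D_xu_i)+\big(B\mathbf{u}(t,x)\big)_i=0\quad\text{in }(0,+\infty)\times\mathbb{R}^N,\qquad i\in\{1,\dots,m\},$$ satisfying $\mathbf{v}^*(0,\cdot)\le\mathbf{u}^0$ on $\mathbb{R}^N$ (componentwise), where $\mathbf{v}^*$ is the upper semicontinuous envelope of $\mathbf{v}$ on $\mathbb{R}_+\times\mathbb{R}^N$.
   Context: $N,m\ge 1$ are integers, $\mathbb{R}_+=[0,+\infty)$. The Hamiltonians $H_1,\dots,H_m:\mathbb{R}^N\times\mathbb{R}^N\to\mathbb{R}$ satisfy: each $H_i$ is uniformly continuous on $\mathbb{R}^N\times B_R$ for every $R>0$ ($B_R$ the open ball of radius $R$ centred at $0$); $p\mapsto H_i(x,p)$ is convex for every $x$; there are superlinear functions $\alpha,\beta:\mathbb{R}_+\to\mathbb{R}$ (i.e. $\alpha(h)/h\to+\infty$, $\beta(h)/h\to+\infty$ as $h\to+\infty$) with $\alpha(|p|)\le H_i(x,p)\le\beta(|p|)$ for all $(x,p)$. The Lagrangians are $L_i(x,q)=\sup_{p}\{\langle p,q\rangle-H_i(x,p)\}$. $B=(b_{ij})$ is a real $m\times m$ matrix with $b_{ij}\le 0$ for $j\ne i$ and $\sum_{j}b_{ij}=0$ for every $i$; $(B\mathbf{u})_i=\sum_jb_{ij}u_j$.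 Viscosity subsolution: for $\mathbf{u}$ locally bounded from above, $u_i^*(t,x)=\limsup_{(s,y)\to(t,x)}u_i(s,y)$ is the upper semicontinuous envelope; $D^+u_i^*(t,x)$ is the set of $(\partial_t\phi(t,x),D_x\phi(t,x))$ with $\phi$ of class $C^1$ near $(t,x)$ such that $u_i^*-\phi$ has a local maximum at $(t,x)$. $\mathbf{u}$ is a subsolution if $p_t+H_i(x,p_x)+(B\mathbf{u}^*(t,x))_i\le 0$ for every $(t,x)\in(0,+\infty)\times\mathbb{R}^N$, every $i$ and every $(p_t,p_x)\in D^+u_i^*(t,x)$. Random frame: $\Omega$ is the space of right-continuous paths $\omega:\mathbb{R}_+\to\{1,\dots,m\}$ with left limits; $\mathcal{F}$ is the $\sigma$-algebra generated by the evaluation maps $\omega\mapsto\omega(t)$, $t\ge0$. $\Omega_i=\{\omega:\omega(0)=i\}$. $\mathbb{P}$ is a probability measure on $(\Omega,\mathcal{F})$ under which $(\omega(t))_{t\ge0}$ is a Markov chain with generator matrix $-B$ (transition matrices $e^{-Bt}$), with $\mathbb{P}(\Omega_i)>0$ for each $i$; $\mathbb{P}_i$ is $\mathbb{P}$ conditioned to $\Omega_i$ (the law of the chain started at $i$) and $\mathbb{E}_i$ the corresponding expectation. Admissible curve: a random variable $\gamma:\Omega\to C(\mathbb{R}_+;\mathbb{R}^N)$ (continuous paths, topology of local uniform convergence), written $\gamma(t,\omega)$, such that (i) for any bounded interval $I$ and $\varepsilon>0$ there is $\delta_\varepsilon>0$ such that $\sum_j(b_j-a_j)<\delta_\varepsilon$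 implies $\sum_j|\gamma(b_j,\omega)-\gamma(a_j,\omega)|<\varepsilon$ for any finite family $\{(a_j,b_j)\}$ of pairwise disjoint intervals contained in $I$ and any $\omega\in\Omega$; (ii) for any $t\ge 0$, $\omega_1\equiv\omega_2$ in $[0,t]$ implies $\gamma(\cdot,\omega_1)\equiv\gamma(\cdot,\omega_2)$ in $[0,t]$. It starts at $x$ if $\gamma(0,\omega)=x$ for every $\omega\in\Omega$. Lax–Oleinik formula: for bounded $\mathbf{u}^0:\mathbb{R}^N\to\mathbb{R}^m$, $t\ge0$, $x\in\mathbb{R}^N$, $i\in\{1,\dots,m\}$, $$(\mathcal{S}(t)\mathbf{u}^0)_i(x)=\inf_{\gamma(0,\omega)=x}\mathbb{E}_i\Big[u^0_{\omega(t)}(\gamma(t,\omega))+\int_0^tL_{\omega(s)}(\gamma(s,\omega),-\dot\gamma(s,\omega))\,ds\Big],$$ the infimum being over admissible curves starting at $x$ (for $t=0$ this gives $\mathcal{S}(0)\mathbf{u}^0=\mathbf{u}^0$). *)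

(* Defs.v *)
From HB Require Import structures.
From mathcomp Require Import all_boot all_order all_algebra.
From mathcomp Require Import all_classical all_reals all_analysis.

Set Implicit Arguments.
Unset Strict Implicit.
Unset Printing Implicit Defensive.

Import Order.TTheory GRing.Theory Num.Theory.
Import numFieldNormedType.Exports.

Local Open Scope classical_set_scope.
Local Open Scope ring_scope.

(* The dimension "N >= 1" and the number "m >= 1" of equations are written
   N.+1 and m.+1 with N, m : nat arbitrary.  R^N is the type of row vectors
   and R^m the type of column vectors, so that B u is [B *m u].  The library
   norm of these types is the max norm; it is only used for topological
   notions, |.| is [enorm]. *)

Section euclidean.
Context {R : realType} {n : nat}.

Definition dotv (p q : 'rV[R]_n) : R := \sum_(k < n) p 0 k * q 0 k.

Definition enorm (p : 'rV[R]_n) : R := Num.sqrt (dotv p p).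

End euclidean.

Section hamiltonians.
Context {R : realType} {N m : nat}.
Implicit Types H : 'I_m.+1 -> 'rV[R]_N.+1 -> 'rV[R]_N.+1 -> R.

(* Only the values on [0, +oo[ matter. *)
Definition superlinear (f : R -> R) := f h / h @[h --> +oo] --> +oo.

Definition unif_cont_on_balls (h : 'rV[R]_N.+1 -> 'rV[R]_N.+1 -> R) :=
  forall r : R, 0 < r -> forall e : R, 0 < e -> exists2 d : R, 0 < d &
    forall x y p q : 'rV[R]_N.+1, enorm p < r -> enorm q < r ->
      enorm (x - y) < d -> enorm (p - q) < d -> `|h x p - h y q| < e.

(* The Lagrangian takes its values in \bar R because the supremum is formed
   there; it is finite when H is superlinear. *)
Definition lagrangian H (i : 'I_m.+1) (x q : 'rV[R]_N.+1) : \bar R :=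
  ereal_sup [set (dotv p q - H i x p)%:E | p in [set: 'rV[R]_N.+1]].

End hamiltonians.

Section viscosity.
Context {R : realType} {N m : nat}.
Local Notation spacetime := (R * 'rV[R]_N.+1)%type.

(* Upper semicontinuous envelope of a function on R_+ x R^N: the limsup at z
   is over the points of R_+ x R^N near z, z included. *)
Definition usc_env (f : spacetime -> R) (z : spacetime) : \bar R :=
  limf_esup (fun y => (f y)%:E) (within [set y | 0 <= y.1] (nbhs z)).

(* u^* as an R^m-valued map; no information is lost by [fine] at the points
   near which u is bounded from above. *)
Definition usc_envv (u : spacetime -> 'cV[R]_m.+1) (z : spacetime) :
    'cV[R]_m.+1 :=
  \col_i fine (usc_env (fun y => u y i 0) z).

Definition dt (phi : spacetime -> R) (z : spacetime) : R :=
  'D_((1, 0) : spacetime) phi z.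

Definition grad_x (phi : spacetime -> R) (z : spacetime) : 'rV[R]_N.+1 :=
  \row_k 'D_((0, delta_mx 0 k) : spacetime) phi z.

Definition C1_near (phi : spacetime -> R) (z : spacetime) :=
  \forall y \near z, differentiable phi y /\
    forall v : spacetime, {for y, continuous (fun w => 'D_v phi w)}.

Definition superdiff (f : spacetime -> R) (z : spacetime) :
    set (R * 'rV[R]_N.+1) :=
  [set p | exists phi : spacetime -> R, [/\ C1_near phi z,
     \forall y \near z, f y - phi y <= f z - phi z &
     p = (dt phi z, grad_x phi z)]].

Definition loc_bounded_above (u : spacetime -> 'cV[R]_m.+1) :=
  forall z : spacetime, 0 < z.1 ->
    exists M : R, \forall y \near z, forall i, u y i 0 <= M.

Definition subsolution (H : 'I_m.+1 -> 'rV[R]_N.+1 -> 'rV[R]_N.+1 -> R)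
    (B : 'M[R]_m.+1) (u : spacetime -> 'cV[R]_m.+1) :=
  loc_bounded_above u /\
  forall (z : spacetime) (i : 'I_m.+1) (p : R * 'rV[R]_N.+1), 0 < z.1 ->
    superdiff (fun y => usc_envv u y i 0) z p ->
    p.1 + H i z.2 p.2 + (B *m usc_envv u z) i 0 <= 0.

End viscosity.

(* Right-continuous paths R_+ -> {1, ..., m} with left limits, the state space
   being discrete.  A path on R_+ is represented by its extension to R which is
   constant on ]-oo, 0], so that equality of paths is equality on R_+. *)
Record cadlag (R : realType) (m : nat) := Cadlag {
  cadlag_fun :> R -> 'I_m.+1;
  cadlag_neg : forall t, t < 0 -> cadlag_fun t = cadlag_fun 0;
  cadlag_right : forall t, 0 <= t ->
    \forall s \near t^'+, cadlag_fun s = cadlag_fun t;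
  cadlag_left : forall t, 0 < t ->
    exists j, \forall s \near t^'-, cadlag_fun s = j }.

Section cadlag_pointed.
Context {R : realType} {m : nat}.

Let cst_neg (t : R) : t < 0 -> cst (ord0 : 'I_m.+1) t = cst (ord0 : 'I_m.+1) (0 : R).
Proof. by []. Qed.

Let cst_right (t : R) : 0 <= t ->
  \forall s \near t^'+, cst (ord0 : 'I_m.+1) s = cst (ord0 : 'I_m.+1) t.
Proof. by move=> _; near=> s. Unshelve. all: by end_near. Qed.

Let cst_left (t : R) : 0 < t ->
  exists j, \forall s \near t^'-, cst (ord0 : 'I_m.+1) s = j.
Proof. by move=> _; exists ord0; near=> s. Unshelve. all: by end_near. Qed.

HB.instance Definition _ := gen_eqMixin (cadlag R m).
HB.instance Definition _ := gen_choiceMixin (cadlag R m).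
HB.instance Definition _ := isPointed.Build (cadlag R m)
  (Cadlag cst_neg cst_right cst_left).

End cadlag_pointed.

Section random_frame.
Context (R : realType) (m : nat).

Definition evaluation_sets : set (set (cadlag R m)) :=
  [set A | exists t j, 0 <= t /\ A = [set w : cadlag R m | w t = j]].

Definition Omega := g_sigma_algebraType evaluation_sets.

Definition Omega_at (i : 'I_m.+1) : set Omega := [set w : cadlag R m | w 0 = i].

Lemma measurable_Omega_at i : measurable (Omega_at i).
Proof. by apply: sub_sigma_algebra; exists 0, i. Qed.

(* P conditioned to Omega_i; the second argument of [mnormalize] is a default
   value that is only used when P (Omega_i) = 0. *)
Definition cond_prob (P : probability Omega R) (i : 'I_m.+1) :
    probability Omega R :=
  mnormalize (mrestr P (measurable_Omega_at i)) P.

Definition expmx (A : 'M[R]_m.+1) : 'M[R]_m.+1 :=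
  limn (series (fun k => (k`!%:R)^-1 *: A ^+ k)).

(* The coordinate process is a Markov chain with transition matrices
   exp (- t B): conditional probabilities are multiplied out. *)
Definition markov_chain (B : 'M[R]_m.+1) (P : probability Omega R) :=
  forall (n : nat) (t : nat -> R) (j : nat -> 'I_m.+1),
    0 <= t 0%N -> (forall k, t k < t k.+1) ->
    P [set w : cadlag R m | forall k, (k <= n.+1)%N -> w (t k) = j k] =
    (P [set w : cadlag R m | forall k, (k <= n)%N -> w (t k) = j k] *
     (expmx (- (t n.+1 - t n) *: B) (j n) (j n.+1))%:E)%E.

End random_frame.

Arguments Omega_at {R m} i _.

Section admissible_curves.
Context {R : realType} {N m : nat}.
Implicit Type gamma : Omega R m -> R -> 'rV[R]_N.+1.

(* C(R_+; R^N) carries the topology of uniform convergence on the compact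
   subsets of R_+.  Curves are represented by functions on R whose values at
   negative times are irrelevant: neither this topology nor any of the
   conditions below depends on them. *)
Definition compact_Rplus (K : set R) := compact K /\ K `<=` `[0, +oo[.

Definition random_curve gamma :=
  (forall w, {within `[0, +oo[, continuous (gamma w)}) /\
  (forall O : set {family compact_Rplus, R -> 'rV[R]_N.+1},
    open O -> measurable (gamma @^-1` O)).

Definition equi_abs_continuous gamma :=
  forall I : set R, is_interval I -> bounded_set I -> I `<=` `[0, +oo[ ->
  forall e : R, 0 < e -> exists2 d : R, 0 < d &
    forall (n : nat) (a b : 'I_n -> R) (w : Omega R m),
      (forall k, a k < b k) -> (forall k, `]a k, b k[ `<=` I) ->
      trivIset setT (fun k => `]a k, b k[%classic) ->
      \sum_(k < n) (b k - a k) < d ->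
      \sum_(k < n) enorm (gamma w (b k) - gamma w (a k)) < e.

Definition nonanticipating gamma :=
  forall (t : R) (w1 w2 : cadlag R m), 0 <= t ->
    (forall s, 0 <= s <= t -> w1 s = w2 s) ->
    forall s, 0 <= s <= t -> gamma w1 s = gamma w2 s.

Definition admissible gamma :=
  [/\ random_curve gamma, equi_abs_continuous gamma & nonanticipating gamma].

End admissible_curves.

Section lax_oleinik.
Context {R : realType} {N m : nat}.
Local Open Scope ereal_scope.

Definition action (H : 'I_m.+1 -> 'rV[R]_N.+1 -> 'rV[R]_N.+1 -> R)
    (u0 : 'rV[R]_N.+1 -> 'cV[R]_m.+1) (t : R)
    (gamma : Omega R m -> R -> 'rV[R]_N.+1) (w : cadlag R m) : \bar R :=
  (u0 (gamma w t) (w t) 0%R)%:E +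
  \int[lebesgue_measure]_(s in `[0%R, t])
    lagrangian H (w s) (gamma w s) (- derive1 (gamma w) s).

(* For bounded u0 and under the assumptions on H the infimum is a real number,
   so that [fine] is harmless. *)
Definition lax_oleinik (H : 'I_m.+1 -> 'rV[R]_N.+1 -> 'rV[R]_N.+1 -> R)
    (P : probability (Omega R m) R) (t : R)
    (u0 : 'rV[R]_N.+1 -> 'cV[R]_m.+1) (x : 'rV[R]_N.+1) : 'cV[R]_m.+1 :=
  \col_i fine (ereal_inf
    [set \int[cond_prob P i]_w action H u0 t gamma w | gamma in
      [set gamma | admissible gamma /\ forall w, gamma w 0%R = x]]).

End lax_oleinik.

(* Main.v *)
(* Starting on the line [x - s q] and restarting at time [h] from a nearly optimal
   curve for the current state gives, by the Markov property,
     v_i(t, x) <= sum_j (e^{-hB})_ij v_j(t - h, x - h q) + h L_i(x, q) + o(h),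
   because the chain started at [i] spends an expected time O(h^2) off [i] before
   time [h].  The inequality passes to the upper semicontinuous envelopes.  Tested
   against [phi] and divided by [h], it yields
     phi_t + <D phi, q> - L_i(x, q) + (B v^* )_i <= 0 for every [q],
   and the supremum over [q] is H_i(x, D phi) by convex duality.  With [q = 0] and
   [h = t] it also gives v_i(t, x) <= u0_i(x) + O(t). *)

Require Import Defs.
From HB Require Import structures.
From mathcomp Require Import all_boot all_order all_algebra.
From mathcomp Require Import all_classical all_reals all_analysis.
From mathcomp Require Import measurable_realfun ring lra.

Set Implicit Arguments.
Unset Strict Implicit.
Unset Printing Implicit Defensive.

Import Order.TTheory GRing.Theory Num.Theory.
Import numFieldNormedType.Exports.

Local Open Scope classical_set_scope.
Local Open Scope ring_scope.

(** * Lagrangians of superlinear Hamiltonians *)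

(** The action may equal [+oo] and no integrability is available, so expectations are not additive
    as they stand. Since [L >= -K] and [|u0| <= M], the Lagrangian is shifted by [K] and the action
    by [M + K * t]: integrands become nonnegative, Tonelli and the change of variables along the
    shift apply, and the shifts cancel at the end.

    Restarting a curve means integrating a function of the shifted path, so the action must be
    measurable in the path. Its integrand contains a derivative and a supremum; both are reduced to
    countably many conditions by rational increments and rational momenta. The Markov hypothesis
    concerns finitely many times; uniqueness of measures turns it into a statement on the law of the
    shifted path.

    The restart point [x - h q] is deterministic, which keeps the curve nonanticipating and lets the
    continuation depend on the state at time [h] only. For fixed [q] the Lagrangian is upper
    semicontinuous in [x], so its value at the base point controls it, up to an error, along the
    whole segment. *)

Lemma coord_le_norm (R : realType) (a b : nat) (A : 'M[R]_(a, b)) i j :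
  `|A i j| <= `|A|.
Proof.
have -> : `|A| = mx_norm A by []; rewrite mx_normrE.
by apply/bigmax_geP; right => /=; exists (i, j).
Qed.

Section euclidean_norm.
Context {R : realType} {n : nat}.
Implicit Types (p q v : 'rV[R]_n) (a : R).

Lemma dotvC p q : dotv p q = dotv q p.
Proof. by apply: eq_bigr => k _; rewrite mulrC. Qed.

Lemma dotvDl p q v : dotv (p + q) v = dotv p v + dotv q v.
Proof. by rewrite -big_split; apply: eq_bigr => k _; rewrite mxE mulrDl. Qed.

Lemma dotvZl a p q : dotv (a *: p) q = a * dotv p q.
Proof. by rewrite mulr_sumr; apply: eq_bigr => k _; rewrite mxE mulrA. Qed.

Lemma dotvNl p q : dotv (- p) q = - dotv p q.
Proof. by rewrite -scaleN1r dotvZl mulN1r. Qed.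

Lemma dotvDr p q v : dotv v (p + q) = dotv v p + dotv v q.
Proof. by rewrite dotvC dotvDl !(dotvC _ v). Qed.

Lemma dotvZr a p q : dotv p (a *: q) = a * dotv p q.
Proof. by rewrite dotvC dotvZl dotvC. Qed.

Lemma dotvNr p q : dotv p (- q) = - dotv p q.
Proof. by rewrite dotvC dotvNl dotvC. Qed.

Lemma dotv_ge0 p : 0 <= dotv p p.
Proof. by apply: sumr_ge0 => k _; rewrite -expr2 sqr_ge0. Qed.

Lemma dotv0l p : dotv 0 p = 0.
Proof. by rewrite -(scale0r 0) dotvZl mul0r. Qed.

Lemma enorm_ge0 p : 0 <= enorm p.
Proof. exact: sqrtr_ge0. Qed.

Lemma sqr_enorm p : enorm p ^+ 2 = dotv p p.
Proof. by rewrite sqr_sqrtr// dotv_ge0. Qed.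

Lemma enorm0 : enorm (0 : 'rV[R]_n) = 0.
Proof. by rewrite /enorm dotv0l sqrtr0. Qed.

Lemma enormZ a p : enorm (a *: p) = `|a| * enorm p.
Proof.
by rewrite /enorm dotvZl dotvZr mulrA -expr2 sqrtrM ?sqr_ge0// sqrtr_sqr.
Qed.

Lemma enormN p : enorm (- p) = enorm p.
Proof. by rewrite -scaleN1r enormZ normrN normr1 mul1r. Qed.

Lemma coord_le_enorm p k : `|p 0 k| <= enorm p.
Proof.
rewrite -sqrtr_sqr ler_sqrt ?dotv_ge0// /dotv (bigD1 k)//= -expr2 lerDl.
by apply: sumr_ge0 => i _; rewrite -expr2 sqr_ge0.
Qed.

Lemma cauchy_schwarz p q : dotv p q <= enorm p * enorm q.
Proof.
have [/eqP q0|q0] := boolP (dotv q q == 0).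
  have -> : dotv p q = 0.
    apply: big1 => k _; have := coord_le_enorm q k.
    by rewrite /enorm q0 sqrtr0 normr_le0 => /eqP ->; rewrite mulr0.
  by rewrite mulr_ge0 ?enorm_ge0.
have qq : 0 < dotv q q by rewrite lt_def q0 dotv_ge0.
have := dotv_ge0 (dotv q q *: p - dotv p q *: q).
rewrite !(dotvDl, dotvDr, dotvNl, dotvNr, dotvZl, dotvZr) (dotvC q p) => h.
have {}h : 0 <= dotv q q * (dotv p p * dotv q q - dotv p q ^+ 2) by lra.
move: h; rewrite pmulr_rge0// subr_ge0 => h.
rewrite /enorm -sqrtrM ?dotv_ge0//; apply: (le_trans (ler_norm _)).
by rewrite -sqrtr_sqr ler_sqrt// mulr_ge0 ?dotv_ge0.
Qed.

Lemma enorm_triangle p q : enorm (p + q) <= enorm p + enorm q.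
Proof.
rewrite -(ler_pXn2r (n := 2))// ?nnegrE ?addr_ge0 ?enorm_ge0//.
rewrite sqrrD !sqr_enorm dotvDl !dotvDr (dotvC q p).
have := cauchy_schwarz p q; lra.
Qed.

Lemma norm_le_enorm p : `|p| <= enorm p.
Proof.
have -> : `|p| = mx_norm p by []; rewrite mx_normrE; apply/bigmax_leP; split => [|[i k] _ /=].
  exact: enorm_ge0.
by rewrite (ord1 i) coord_le_enorm.
Qed.

Lemma enorm_le_norm p : enorm p <= Num.sqrt n%:R * `|p|.
Proof.
rewrite -[X in _ * X]ger0_norm// -sqrtr_sqr -sqrtrM// ler_sqrt; last first.
  by rewrite mulr_ge0// sqr_ge0.
apply: le_trans (_ : \sum_(k < n) `|p| ^+ 2 <= _); last first.
  by rewrite sumr_const card_ord mulr_natl.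
apply: ler_sum => k _; rewrite -expr2 -real_normK ?num_real//.
by rewrite lerXn2r ?nnegrE// coord_le_norm.
Qed.

Lemma nbhs_enorm v (d : R) : 0 < d -> \forall w \near v, enorm (w - v) < d.
Proof.
move=> d0; pose e := d / (Num.sqrt n%:R + 1).
have c0 : 0 < Num.sqrt n%:R + 1 :> R by rewrite ltr_wpDl// sqrtr_ge0.
have e0 : 0 < e by rewrite divr_gt0.
near=> w.
apply: le_lt_trans (enorm_le_norm _) _.
have : `|w - v| < e by near: w; exact: (@cvgr_distC_lt _ _ _ (nbhs v) _ id v cvg_id).
move=> h; apply: le_lt_trans (_ : (Num.sqrt n%:R + 1) * `|w - v| < _).
  by rewrite ler_wpM2r// lerDl.
by rewrite mulrC -ltr_pdivlMr.
Unshelve. all: by end_near. Qed.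

End euclidean_norm.

Section lagrangian_bounds.
Context {R : realType} {N m : nat}.
Variables (H : 'I_m.+1 -> 'rV[R]_N.+1 -> 'rV[R]_N.+1 -> R).
Variables (alpha beta : R -> R).
Hypothesis H_unif : forall i, unif_cont_on_balls (H i).
Hypothesis H_bounds : forall i x p, alpha (enorm p) <= H i x p <= beta (enorm p).
Implicit Types x p q : 'rV[R]_N.+1.

Lemma lagrangian_ge i x q p : ((dotv p q - H i x p)%:E <= lagrangian H i x q)%E.
Proof. by apply: ereal_sup_ubound; exists p. Qed.

Lemma lagrangian_lower_bound i x q : ((- beta 0)%:E <= lagrangian H i x q)%E.
Proof.
apply: le_trans (lagrangian_ge i x q 0).
by rewrite lee_fin dotv0l sub0r lerN2 -(enorm0 (n := N.+1)); case/andP: (H_bounds i x 0).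
Qed.

(** [alpha] is arbitrary on bounded intervals, so [alpha (enorm p)] may be unbounded below on a
    ball. The bound starts from [alpha 0]: [p] is reached from 0 in [n] steps shorter than [d], and
    by uniform continuity [H i x] changes by at most 1 at each of them, whatever [x]. *)
Lemma hamiltonian_lower_bound i (r : R) : 0 < r ->
  exists K : R, forall x p, enorm p < r -> - K <= H i x p.
Proof.
move=> r0; have [d d0 hd] := H_unif i r0 ltr01.
pose n := (Num.truncn (r / d)).+1.
have n0 : 0 < n%:R :> R by rewrite ltr0n.
have rn : r / n%:R < d.
  by rewrite ltr_pdivrMr// mulrC -ltr_pdivrMr// truncnS_gt.
exists (n%:R - alpha 0) => x p pr.
have step (k : nat) : (k <= n)%N -> `|H i x ((k%:R / n%:R) *: p) - H i x 0| <= k%:R.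
  elim: k => [|k IH] kn; first by rewrite mul0r scale0r subrr normr0.
  have in_ball j : (j <= n)%N -> enorm ((j%:R / n%:R) *: p) < r.
    move=> jn; rewrite enormZ ger0_norm; last by rewrite divr_ge0.
    apply: le_lt_trans pr; rewrite ler_piMl ?enorm_ge0//.
    by rewrite ler_pdivrMr// mul1r ler_nat.
  have := hd x x _ _ (in_ball _ kn) (in_ball _ (ltnW kn)).
  rewrite subrr enorm0 -scalerBl -mulrBl -natrB// subSnn => /(_ d0).
  rewrite enormZ ger0_norm ?divr_ge0// => h.
  have {}h := h _; have /h{}h : 1 / n%:R * enorm p < d.
    apply: lt_trans rn; rewrite mul1r mulrC ltr_pM2r// invr_gt0//.
  move: h (IH (ltnW kn)); set a := H i x _; set b := H i x _; set c := H i x 0 => h1 h2.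
  rewrite -natr1.
  rewrite (_ : a - c = (a - b) + (b - c)); last by ring.
  by apply: le_trans (ler_normD _ _) _; rewrite addrC lerD// ltW.
have := step n (leqnn _); rewrite divff ?gt_eqF// scale1r.
have := andP (H_bounds i x 0); rewrite enorm0 => -[h _].
by rewrite ler_norml => /andP[h2 _]; lra.
Qed.

Hypothesis alpha_super : superlinear alpha.

Lemma superlinear_ge (f : R -> R) (a : R) : superlinear f ->
  exists2 r : R, 0 < r & forall h, r <= h -> a * h <= f h.
Proof.
move=> /cvgryPge /(_ a) [M [_ hM]].
exists (Num.max M 0 + 1); first by rewrite ltr_wpDl// le_max lexx orbT.
move=> h rh; have [Mh h0] : M < h /\ 0 < h.
  split; apply: lt_le_trans rh; rewrite ltr_pwDr// ?le_max ?lexx ?orbT//.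
by have := hM h Mh; rewrite ler_pdivlMr.
Qed.

(** Past a radius [r] where [alpha] dominates the slope [|q|], Cauchy-Schwarz makes [<p, q> - H]
    nonpositive; inside, it is at most [r |q| + K] with [K] from the lower bound on balls. Neither
    estimate depends on [x]. *)
Lemma lagrangian_upper_bound q :
  exists2 C : R, 0 <= C & forall i x, (lagrangian H i x q <= C%:E)%E.
Proof.
suff h i : exists C, forall x, (lagrangian H i x q <= C%:E)%E.
  have [C hC] := choice h; exists (\sum_i `|C i|); first exact: sumr_ge0.
  move=> i x; apply: le_trans (hC i x) _; rewrite lee_fin (bigD1 i)//=.
  by apply: le_trans (ler_norm _) _; rewrite lerDl sumr_ge0.
have [r r0 hr] := superlinear_ge (enorm q) alpha_super.
have [K hK] := hamiltonian_lower_bound i r0.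
exists (`|r * enorm q + K|) => x; apply: ge_ereal_sup => _ [p _ <-].
rewrite lee_fin; have cs := cauchy_schwarz p q.
have [pr|rp] := ltP (enorm p) r.
  apply: le_trans (ler_norm _).
  have := hK x p pr; have := ler_wpM2r (enorm_ge0 q) (ltW pr); lra.
apply: le_trans (normr_ge0 _); have := hr _ rp.
by have /andP[+ _] := H_bounds i x p; lra.
Qed.

(** Momenta of norm at least [r'] are not competitive: there [<p, q> - H <= - enorm p <= - beta 0],
    which is below every value of the Lagrangian. On the remaining ball [H] is continuous in [x]
    uniformly in [p]. *)
Lemma lagrangian_usc i x0 q (e : R) : 0 < e ->
  exists2 d : R, 0 < d & forall x, enorm (x - x0) < d ->
    (lagrangian H i x q <= lagrangian H i x0 q + e%:E)%E.
Proof.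
move=> e0.
have [r r0 hr] := superlinear_ge (enorm q + 1) alpha_super.
pose r' := Num.max r `|beta 0| + 1.
have r'0 : 0 < r' by rewrite ltr_wpDl// le_max (ltW r0).
have [d d0 hd] := H_unif i r'0 e0.
exists d => // x xd; apply: ge_ereal_sup => _ [p _ <-].
have [pr|rp] := ltP (enorm p) r'.
  apply: le_trans (leeD2r _ (lagrangian_ge i x0 q p)).
  rewrite lee_fin; have := hd _ _ _ _ pr pr xd; rewrite subrr enorm0 => /(_ d0).
  by rewrite ltr_norml => /andP[h1 h2]; lra.
have rp1 : r <= enorm p.
  by apply: le_trans rp; rewrite ler_wpDr// le_max lexx.
have rp2 : `|beta 0| <= enorm p.
  by apply: le_trans rp; rewrite ler_wpDr// le_max lexx orbT.
apply: le_trans (leeD2r _ (lagrangian_lower_bound i x0 q)).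
rewrite lee_fin; have := hr _ rp1; have /andP[+ _] := H_bounds i x p.
by have := cauchy_schwarz p q; have := ler_norm (beta 0); lra.
Qed.

Hypothesis H_convex : forall i x, convex_function [set: 'rV[R]_N.+1] (H i x).

Lemma hamiltonian_convex i x p q (s : R) : 0 <= s <= 1 ->
  H i x (p + s *: (q - p)) <= H i x p + s * (H i x q - H i x p).
Proof.
case/andP=> s0 s1; pose t := Itv01 s0 s1.
have := H_convex i x t (in_setT q) (in_setT p).
rewrite convRE [conv _ _ _]/(s *: q + (1 - s) *: p) /= /unstable.onem.
rewrite scalerBr scalerBl scale1r => h.
have -> : p + (s *: q - s *: p) = s *: q + (p - s *: p) by rewrite addrCA.
by apply: le_trans h _; lra.
Qed.

Lemma hamiltonian_continuous i x : continuous (H i x).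
Proof.
move=> p; apply/(@cvgrPdist_lt R R^o _ (nbhs p)) => e e0.
have r0 : 0 < enorm p + 1 by rewrite ltr_wpDl// enorm_ge0.
have [d d0 hd] := H_unif i r0 e0.
near=> q.
have pq : enorm (q - p) < Num.min d 1.
  by near: q; apply: nbhs_enorm; rewrite lt_min d0 ltr01.
move: pq; rewrite lt_min => /andP[pq1 pq2].
apply: hd.
- by rewrite ltrDl.
- rewrite -(subrK p q) addrC; apply: le_lt_trans (enorm_triangle _ _) _.
  by rewrite ltrD2l.
- by rewrite subrr enorm0.
- by rewrite -opprB enormN.
Unshelve. all: by end_near. Qed.

Lemma dotv_continuous : continuous (fun p : 'rV[R]_N.+1 => dotv p p).
Proof.
apply: (@continuous_big R 'I_N.+1 +%R 0 predT _ 'rV[R]_N.+1 (index_enum _)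
  (fun k p => p 0 k * p 0 k)).
  by move=> z; apply: (@cvgD R R^o); [exact: cvg_fst|exact: cvg_snd].
by move=> k _ p; apply: (@continuousM R _ (fun p => p 0 k) (fun p => p 0 k));
  exact: coord_continuous.
Qed.

Lemma dotvl_continuous q : continuous (fun p : 'rV[R]_N.+1 => dotv p q).
Proof.
apply: (@continuous_big R 'I_N.+1 +%R 0 predT _ 'rV[R]_N.+1 (index_enum _)
  (fun k p => p 0 k * q 0 k)).
  by move=> z; apply: (@cvgD R R^o); [exact: cvg_fst|exact: cvg_snd].
move=> k _ p; apply: (@continuousM R _ (fun p => p 0 k) (cst (q 0 k))).
  exact: coord_continuous.
exact: cst_continuous.
Qed.

(* A minimiser [p'] of [H + n |. - p|^2] near [p] has the subgradient
   [2 n (p - p')], which avoids any separation theorem. *)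
Lemma hamiltonian_le_biconjugate i x p (e : R) : 0 < e ->
  exists q, (lagrangian H i x q <= (dotv p q - H i x p + e)%:E)%E.
Proof.
move=> e0; have r0 : 0 < enorm p + Num.sqrt N.+1%:R + 1.
  by rewrite ltr_wpDl// addr_ge0 ?enorm_ge0 ?sqrtr_ge0.
have [d d0 hd] := H_unif i r0 e0.
have c0 : 0 < Num.sqrt N.+1%:R :> R by rewrite sqrtr_gt0.
(* The library ball is for the max norm: the factor [sqrt (N.+1)] makes every point of [A] closer
   than [d] to [p] in Euclidean norm, and the bound 1 keeps [A] inside the ball on which [H_unif]
   was invoked. *)
pose de := Num.min (d / 2 / Num.sqrt N.+1%:R) 1.
have de0 : 0 < de by rewrite lt_min ltr01 andbT !divr_gt0.
pose A := closed_ball p de.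
have hA p' : A p' -> H i x p - e < H i x p'.
  rewrite /A closed_ballE// /closed_ball_ /= -opprB normrN => pp'.
  have h1 : enorm (p' - p) <= Num.sqrt N.+1%:R * de.
    by apply: le_trans (enorm_le_norm _) _; rewrite ler_pM2l.
  have h2 : enorm (p' - p) < d.
    apply: le_lt_trans h1 _.
    rewrite (@le_lt_trans _ _ (Num.sqrt N.+1%:R * (d / 2 / Num.sqrt N.+1%:R)))//.
      by rewrite ler_pM2l// ge_min lexx.
    rewrite mulrC divfK ?gt_eqF//; lra.
  have h3 : enorm (p' - p) <= Num.sqrt N.+1%:R.
    by apply: le_trans h1 _; rewrite ler_piMr ?(ltW c0)// ge_min lexx orbT.
  have := hd x x p p'; rewrite subrr enorm0 -opprB enormN => h.
  have : `|H i x p - H i x p'| < e.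
    apply: h => //; first by have := ltW c0; lra.
    rewrite -(subrK p p') addrC; apply: le_lt_trans (enorm_triangle _ _) _; lra.
  by rewrite ltr_norml => /andP[]; lra.
(* On the boundary of [A] the penalty is at least [n * de ^+ 2 = e + 1], more than [H] can drop
   within [A]; hence the minimiser is interior. *)
pose n := (e + 1) / de ^+ 2.
have n0 : 0 < n by rewrite divr_gt0 ?exprn_gt0//; lra.
pose f p' := H i x p' + n * dotv (p' - p) (p' - p).
have fc : continuous f.
  move=> p'; apply: (@continuousD R R^o _ (H i x) (fun p' => n * dotv (p' - p) (p' - p))).
    exact: hamiltonian_continuous.
  apply: (@continuousM R _ (cst n) (fun p' => dotv (p' - p) (p' - p))).
    exact: cst_continuous.
  apply: (@continuous_comp _ _ _ (fun p' => p' - p) (fun v => dotv v v)).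
    by apply: (@continuousB R 'rV[R]_N.+1 _ id (cst p)); [move=> ?|exact: cst_continuous].
  exact: dotv_continuous.
have [|||p0 p0A p0min] := @EVT_min_rV _ _ f A _ _ _.
- by exists p; exact: closed_ballxx.
- apply: bounded_closed_compact; last exact: closed_ball_closed.
  exists (`|p| + de); split; first exact: num_real.
  move=> M hM p'; rewrite /A closed_ballE// /closed_ball_ /= => pp'.
  apply: le_trans (ltW hM); rewrite -(subrK p p') addrC.
  by apply: le_trans (ler_normD _ _) _; rewrite lerD2l distrC.
- exact: continuous_subspaceT.
move: p0A; rewrite inE => p0A.
have hp0 := hA _ p0A.
have fp0 : f p0 <= f p by apply: p0min; rewrite inE; exact: closed_ballxx.
have small : dotv (p0 - p) (p0 - p) < de ^+ 2.
  move: fp0; rewrite /f subrr dotv0l mulr0 addr0 => fp0.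
  have : n * dotv (p0 - p) (p0 - p) < n * de ^+ 2.
    rewrite [ltRHS](_ : _ = e + 1); first lra.
    by rewrite /n divfK// gt_eqF// exprn_gt0.
  by rewrite ltr_pM2l.
have p0in : `|p0 - p| < de.
  apply: le_lt_trans (norm_le_enorm _) _.
  by rewrite -(ltr_pXn2r (n := 2)) ?nnegrE ?enorm_ge0 ?(ltW de0)// sqr_enorm.
pose q := (- (2 * n)) *: (p0 - p); exists q.
(* This suffices because [<p0 - p, q> = - 2 n |p0 - p|^2 <= 0] and [H p0 > H p - e]. *)
suff subg p' : H i x p0 + dotv (p' - p0) q <= H i x p'.
  apply: ge_ereal_sup => _ [p' _ <-]; rewrite lee_fin.
  have := subg p'.
  rewrite /q !dotvZr !(dotvDl, dotvDr, dotvNl, dotvNr).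
  have := dotv_ge0 (p - p0); rewrite !(dotvDl, dotvDr, dotvNl, dotvNr).
  rewrite (dotvC p0 p).
  set a := dotv p p; set b := dotv p p0; set c := dotv p0 p0.
  move=> h1 h2; have h3 : 0 <= n * (a - b + (- b - - c)) by rewrite mulr_ge0 ?(ltW n0)//; lra.
  lra.
apply/ler_addgt0Pr => e' e'0.
pose w := p' - p0.
(* Minimality is used at [p0 + s w]: the first bound keeps this point in [A], the second allows
   convexity, the third makes the quadratic remainder [s n |w|^2] at most [e']. *)
pose s := Num.min (Num.min ((de - `|p0 - p|) / (`|w| + 1)) 1) (e' / (n * dotv w w + 1)).
have w0 := dotv_ge0 w.
have nw0 : 0 <= n * dotv w w by rewrite mulr_ge0// ltW.
have s0 : 0 < s.
  rewrite !lt_min ltr01 divr_gt0 ?divr_gt0 ?subr_gt0//; by rewrite ltr_wpDl.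
have s1 : s <= 1 by rewrite !ge_min lexx orbT.
have sA : A (p0 + s *: w).
  rewrite /A closed_ballE// /closed_ball_ /= -opprB normrN addrAC.
  apply: le_trans (ler_normD _ _) _; rewrite normrZ gtr0_norm//.
  have : s * `|w| <= de - `|p0 - p|; last by lra.
  apply: le_trans (_ : s * (`|w| + 1) <= _).
    by rewrite ler_pM2l// lerDl.
  rewrite -ler_pdivlMr; first by rewrite !ge_min lexx.
  by rewrite ltr_wpDl.
have se : s * (n * dotv w w) <= e'.
  apply: le_trans (_ : s * (n * dotv w w + 1) <= _).
    by rewrite ler_pM2l// lerDl.
  rewrite -ler_pdivlMr; first by rewrite !ge_min lexx orbT.
  by rewrite ltr_wpDl.
have fm : f p0 <= f (p0 + s *: w) by apply: p0min; rewrite inE.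
have hc : H i x (p0 + s *: w) <= H i x p0 + s * (H i x p' - H i x p0).
  by apply: hamiltonian_convex; rewrite (ltW s0) s1.
move: fm; rewrite /f (addrAC p0).
rewrite -/w /q dotvZr.
rewrite (dotvDl (p0 - p)) !(dotvDr (p0 - p)) !dotvZl !dotvZr (dotvC (p0 - p) w).
set a := dotv (p0 - p) _; set b := dotv w _; move: (dotv w w) se => c se fm.
have key : 0 <= s * (H i x p' - H i x p0 + 2 * n * b + s * (n * c)) by lra.
move: key; rewrite pmulr_rge0//; lra.
Qed.

End lagrangian_bounds.

(** * Transition matrices at small times *)

Lemma cvg_matrix (K : numFieldType) (m n : nat) (T : Type) (F : set_system T)
    (FF : Filter F) (f : T -> 'M[K]_(m, n)) (M : 'M[K]_(m, n)) :
  (forall i j, f x i j @[x --> F] --> M i j) -> f @ F --> M.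
Proof.
move=> fM Q [P PM PQ]; rewrite /fmap /=; apply: (@filterS _ _ _ [set x | forall i j, P i j (f x i j)]).
  by move=> x Px; apply: PQ => i j; exact: Px.
by apply: filter_forall => i; apply: filter_forall => j; apply: fM; exact: PM.
Qed.

Section matrix_exponential.
Context {R : realType} {m : nat}.
Implicit Types A B : 'M[R]_m.+1.

Lemma coord_mx_pow_le A (c : R) k i j : (forall i j, `|A i j| <= c) ->
  `|(A ^+ k) i j| <= (m.+1%:R * c) ^+ k.
Proof.
move=> Ac; elim: k i j => [|k IH] i j.
  by rewrite !expr0 mxE; case: (i == j); rewrite ?normr1 ?normr0.
rewrite !exprSr -mulmxE mxE; apply: le_trans (ler_norm_sum _ _ _) _.
have -> : (m.+1%:R * c) ^+ k * (m.+1%:R * c) = \sum_(l < m.+1) (m.+1%:R * c) ^+ k * c.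
  by rewrite sumr_const card_ord -[RHS]mulr_natl mulrCA.
apply: ler_sum => l _; rewrite normrM ler_pM//.
Qed.

(** [expmx] is a [limn], meaningful only once the series converges. Entrywise it is dominated by the
    exponential series of [m.+1 * c], with [c] the sum of all [|A i j|]. *)
Lemma cvg_series_expmx A : cvgn (series (fun k => (k`!%:R)^-1 *: A ^+ k)).
Proof.
pose c : R := \sum_i \sum_j `|A i j|.
have Ac i j : `|A i j| <= c.
  rewrite /c (bigD1 i)//= (bigD1 j)//= -addrA lerDl addr_ge0// ?sumr_ge0// => k _.
  by rewrite sumr_ge0.
apply/cvg_ex; exists (\matrix_(i, j) limn (fun n => series (fun k => (k`!%:R)^-1 *: A ^+ k) n i j)).
apply: cvg_matrix => i j; rewrite mxE.
have -> : (fun n => series (fun k => (k`!%:R)^-1 *: A ^+ k) n i j) =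
    series (fun k => (k`!%:R)^-1 * (A ^+ k) i j).
  by apply/funext => n; rewrite /series/= summxE; apply: eq_bigr => k _; rewrite mxE.
apply: (@normed_cvg R R^o).
apply: (@series_le_cvg _ _ (exp_coeff (m.+1%:R * c))).
- by move=> n; exact: normr_ge0.
- by move=> n; apply: exp_coeff_ge0; rewrite mulr_ge0// (le_trans _ (Ac 0 0)).
- move=> k; rewrite exp_coeffE /= normrM ger0_norm ?invr_ge0// ler_wpM2l ?invr_ge0//.
  exact: coord_mx_pow_le.
- exact: is_cvg_series_exp_coeff.
Qed.

(** Removing the terms of order 0 and 1 leaves the series from order 2 on, where [h ^+ k <= h ^+ 2]
    because [h <= 1]; the rest is bounded by the exponential of [m.+1 * b]. *)
Lemma expmx_first_order B : exists2 c : R, 0 <= c & forall h i j, 0 <= h <= 1 ->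
  `|expmx ((- h) *: B) i j - (i == j)%:R + h * B i j| <= c * h ^+ 2.
Proof.
pose b : R := \sum_i \sum_j `|B i j|.
have Bb i j : `|B i j| <= b.
  rewrite /b (bigD1 i)//= (bigD1 j)//= -addrA lerDl addr_ge0// ?sumr_ge0// => k _.
  by rewrite sumr_ge0.
have b0 : 0 <= b by rewrite (le_trans _ (Bb 0 0)).
pose e := expR (m.+1%:R * b).
exists e; first exact: expR_ge0.
move=> h i j /andP[h0 h1].
set A := (- h) *: B.
have Ab i' j' : `|A i' j'| <= h * b.
  by rewrite mxE normrM normrN (ger0_norm h0) ler_wpM2l.
set S := series (fun k => (k`!%:R)^-1 *: A ^+ k).
have SL : S n i j @[n --> \oo] --> expmx A i j.
  apply: (@continuous_cvg _ _ _ _ _ S (fun M : 'M[R]_m.+1 => M i j)).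
    exact: coord_continuous.
  exact: cvg_series_expmx.
have SL' : `|S n i j - (i == j)%:R + h * B i j| @[n --> \oo] -->
    `|expmx A i j - (i == j)%:R + h * B i j|.
  apply: cvg_norm; apply: cvgD; last exact: cvg_cst.
  by apply: cvgB; [exact: SL | exact: cvg_cst].
apply: (cvgr_to_le SL'); exists 2%N => // n /= n2.
have -> : S n i j - (i == j)%:R + h * B i j =
    \sum_(2 <= k < n) (k`!%:R)^-1 * (A ^+ k) i j.
  rewrite /S /series /= summxE (big_cat_nat (n := 2))//=.
  under [X in _ + X - _]eq_bigr do rewrite mxE.
  rewrite [X in X + _ - _](_ : _ = (i == j)%:R - h * B i j); first by lra.
  by rewrite big_ltn// big_nat1 !fact0 !mulr1n invr1 !scale1r expr0 expr1 !mxE mulNr.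
apply: le_trans (ler_norm_sum _ _ _) _.
apply: (@le_trans _ _ (\sum_(2 <= k < n) h ^+ 2 * exp_coeff (m.+1%:R * b) k)).
  apply: ler_sum_nat => k /andP[k2 _].
  rewrite exp_coeffE normrM ger0_norm ?invr_ge0// mulrCA ler_wpM2l ?invr_ge0//.
  apply: le_trans (coord_mx_pow_le k _ _ Ab) _.
  rewrite mulrCA exprMn ler_wpM2r ?exprn_ge0 ?mulr_ge0//.
  by rewrite -(subnK k2) exprD ler_piMl ?exprn_ge0// exprn_ile1.
rewrite -mulr_sumr mulrC ler_wpM2r ?exprn_ge0//.
apply: (@le_trans _ _ (series (exp_coeff (m.+1%:R * b)) n)).
  rewrite /series /= [leRHS](big_cat_nat (n := 2))//= lerDr sumr_ge0// => k _.
  by rewrite exp_coeff_ge0// mulr_ge0.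
apply: nondecreasing_cvgn_le; last exact: is_cvg_series_exp_coeff.
by apply: nondecreasing_series => k _ _; rewrite exp_coeff_ge0// mulr_ge0.
Qed.

End matrix_exponential.

(** * The Markov property as a law of the shifted path *)

Lemma nbhs_at_right (R : realType) (t : R) (P : set R) :
  (\forall s \near t^'+, P s) <-> exists2 e : R, 0 < e & forall s, t < s < t + e -> P s.
Proof.
split => [[/= e e0 he]|[e e0 he]].
  exists e => // s /andP[ts se]; apply: (he s) => //=.
  by rewrite distrC ger0_norm ?subr_ge0 ?(ltW ts)//; lra.
exists e => //= s /=; rewrite distrC ltr_norml => /andP[h1 h2] ts; apply: he.
by apply/andP; split => //; lra.
Qed.

Lemma nbhs_at_left (R : realType) (t : R) (P : set R) :
  (\forall s \near t^'-, P s) <-> exists2 e : R, 0 < e & forall s, t - e < s < t -> P s.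
Proof.
split => [[/= e e0 he]|[e e0 he]].
  exists e => // s /andP[ts se]; apply: (he s) => //=.
  by rewrite ger0_norm ?subr_ge0 ?(ltW se)//; lra.
exists e => //= s /=; rewrite ltr_norml => /andP[h1 h2] ts; apply: he.
by apply/andP; split => //; lra.
Qed.

Section shift.
Context {R : realType} {m : nat}.
Variables (h : R) (h0 : 0 <= h).

(** Paths are constant on negative times by convention, which plain translation by [h] would violate
    on [[-h, 0[]; hence the [Num.max]. *)
Let shift_fun (w : cadlag R m) (t : R) := w (h + Num.max t 0).

Let shift_neg w t : t < 0 -> shift_fun w t = shift_fun w 0.
Proof. by move=> t0; rewrite /shift_fun maxxx max_r// ltW. Qed.

Let shift_right w t : 0 <= t -> \forall s \near t^'+, shift_fun w s = shift_fun w t.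
Proof.
move=> t0; have ht0 : 0 <= h + t by rewrite addr_ge0.
have /nbhs_at_right[e e0 he] := cadlag_right w ht0.
apply/nbhs_at_right; exists e => // s /andP[ts se].
rewrite /shift_fun !max_l ?(ltW (le_lt_trans t0 ts))// he//.
by rewrite ltrD2l ts -addrA ltrD2l.
Qed.

Let shift_left w t : 0 < t -> exists j, \forall s \near t^'-, shift_fun w s = j.
Proof.
move=> t0; have ht0 : 0 < h + t by rewrite ltr_wpDl.
have [j /nbhs_at_left[e e0 he]] := cadlag_left w ht0.
exists j; apply/nbhs_at_left; exists (Num.min e t); first by rewrite lt_min e0.
move=> s /andP[ts st]; have s0 : 0 <= s.
  by apply: ltW; apply: le_lt_trans ts; rewrite subr_ge0 ge_min lexx orbT.
rewrite /shift_fun max_l// he// ltrD2l st andbT -addrA ltrD2l.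
by apply: le_lt_trans ts; rewrite lerB// ge_min lexx.
Qed.

Definition shift_path (w : Omega R m) : Omega R m :=
  Cadlag (@shift_neg w) (@shift_right w) (@shift_left w).

Lemma shift_pathE w t : 0 <= t -> (shift_path w : cadlag R m) t = (w : cadlag R m) (h + t).
Proof. by move=> t0; rewrite /= /shift_fun max_l. Qed.

Lemma measurable_eval t j : measurable ([set w : cadlag R m | w t = j] : set (Omega R m)).
Proof.
have [t0|t0] := leP 0 t; first by apply: sub_sigma_algebra; exists t, j.
rewrite (_ : mkset _ = Omega_at j); first exact: measurable_Omega_at.
by apply/seteqP; split => w /=; rewrite (cadlag_neg w t0).
Qed.

Lemma measurable_shift_path : measurable_fun setT shift_path.
Proof.
apply: (@measurability _ _ _ (Omega R m) setT _ (@evaluation_sets R m)) => //.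
move=> _ [_ [t [j [t0 ->]]] <-]; rewrite setTI.
rewrite (_ : _ @^-1` _ = [set w : cadlag R m | w (h + t) = j]); last first.
  by apply/seteqP; split => w /=; rewrite -shift_pathE.
exact: measurable_eval.
Qed.

End shift.

Section cylinders.
Context {R : realType} {m : nat}.
Implicit Types (s : seq R) (a : R -> 'I_m.+1).

Definition cylinder s a : set (Omega R m) :=
  [set w : cadlag R m | forall t, t \in s -> w t = a t].

(** Two cylinders with conflicting prescriptions have empty intersection, hence the extra member
    [set0]. Time 0 is always prescribed, so that a cylinder lies in a single [Omega_at]. *)
Definition cylinders : set (set (Omega R m)) := [set A | A = set0 \/
  exists s a, [/\ 0 \in s, forall t, t \in s -> 0 <= t & A = cylinder s a]].

Lemma measurable_cylinder s a : measurable (cylinder s a).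
Proof.
rewrite (_ : cylinder s a = \big[setI/setT]_(t <- s) [set w : cadlag R m | w t = a t]).
  by apply: bigsetI_measurable => t _; exact: measurable_eval.
rewrite -bigcap_seq; apply/seteqP; split => w /=; first by move=> h t /=; exact: h.
by move=> h t /=; exact: h.
Qed.

Lemma setI_closed_cylinders : setI_closed cylinders.
Proof.
move=> A B [->|[s [a [s0 sp ->]]]]; first by move=> _; left; rewrite set0I.
move=> [->|[s' [a' [s'0 sp' ->]]]]; first by left; rewrite setI0.
have [ag|] := pselect (forall t, t \in s -> t \in s' -> a t = a' t); last first.
  move=> nag; left; apply/seteqP; split => // w [h1 h2]; apply: nag => t ts ts'.
  by rewrite -h1// -h2.
right; exists (s ++ s'), (fun t => if t \in s then a t else a' t); split.
- by rewrite mem_cat s0.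
- by move=> t; rewrite mem_cat => /orP[/sp|/sp'].
apply/seteqP; split => w.
  move=> [h1 h2] t; rewrite mem_cat; case: ifP => [ts _|_ /=]; first exact: h1.
  exact: h2.
move=> h; split => t ts.
  by rewrite h ?mem_cat ts.
rewrite h ?mem_cat ?ts ?orbT//; case: ifP => // ts'; exact: ag.
Qed.

(** A condition at a time [t > 0] is the union, over the initial state, of cylinders with times 0
    and [t]. *)
Lemma cylinders_generate :
  (measurable : set (set (Omega R m))) = <<s cylinders >>.
Proof.
apply/seteqP; split; last first.
  apply: smallest_sub; first exact: sigma_algebra_measurable.
  by move=> A [->|[s [a [_ _ ->]]]]; [exact: measurable0|exact: measurable_cylinder].
apply: smallest_sub; first exact: smallest_sigma_algebra.
move=> _ [t [j [t0 ->]]].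
have [->|tn0] := eqVneq t 0.
  apply: sub_sigma_algebra; right; exists [:: 0], (cst j).
  split; [by rewrite inE|by move=> u; rewrite inE => /eqP ->|].
  apply/seteqP; split => w /=; first by move=> h u; rewrite inE => /eqP ->.
  by move=> /(_ 0); rewrite inE; exact.
pose F i := cylinder [:: 0; t] (fun u => if u == 0 then i else j).
rewrite (_ : mkset _ = \bigcup_(k in [set: nat]) F (inord k)); last first.
  apply/seteqP; split => w /=.
    move=> wt; exists (w 0 : nat) => // u; rewrite !inE inord_val.
    by case: eqVneq => [->|u0 /=] // /eqP ->.
  by move=> [k _ /(_ t)]; rewrite !inE eqxx orbT (negbTE tn0); exact.
apply: sigma_algebra_bigcup => k.
apply: sub_sigma_algebra; right; exists [:: 0; t], (fun u => if u == 0 then inord k else j).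
by split; rewrite ?inE ?eqxx// => u; rewrite !inE => /orP[/eqP ->|/eqP ->].
Qed.

Lemma cylinder_increasing s a : 0 \in s -> (forall t, t \in s -> 0 <= t) ->
  exists (n : nat) (t : nat -> R), [/\ t 0%N = 0, forall k, t k < t k.+1 &
    cylinder s a = [set w : cadlag R m | forall k, (k <= n)%N -> w (t k) = a (t k)]].
Proof.
move=> s0 sp; pose s' := sort <=%R (undup s).
have ms u : (u \in s') = (u \in s) by rewrite mem_sort mem_undup.
have ss : sorted <%R s'.
  by rewrite lt_sorted_uniq_le sort_uniq undup_uniq sort_le_sorted.
have sz : (0 < size s')%N by rewrite lt0n size_eq0; apply/eqP => s'0; move: s0; rewrite -ms s'0.
(* [markov_chain] asks for an infinite strictly increasing sequence of times: the sorted times of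
   [s] are continued beyond the last one by unit steps. *)
exists (size s').-1, (fun k => nth 0 s' (minn k (size s').-1) + (k - (size s').-1)%:R).
have tE k : (k <= (size s').-1)%N ->
    nth 0 s' (minn k (size s').-1) + (k - (size s').-1)%:R = nth 0 s' k :> R.
  by move=> kn; rewrite (minn_idPl kn) (eqP kn) addr0.
split.
- rewrite tE//; apply/eqP; rewrite eq_le; apply/andP; split.
    have /(nthP 0)[k ks ks0] : 0 \in s' by rewrite ms.
    by rewrite -{2}ks0 (sorted_leq_nth le_trans le_refl) ?inE// sort_le_sorted.
  by apply: sp; rewrite -ms mem_nth.
- move=> k; case: (boolP (k < (size s').-1)%N) => [kn|]; last rewrite -leqNgt => nk.
    rewrite (tE _ (ltnW kn)) (tE _ kn); apply: (sorted_ltn_nth lt_trans) => //; rewrite ?inE//.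
      by rewrite (leq_trans kn)// leq_pred.
    by rewrite -(prednK sz) ltnS.
  by rewrite !(minn_idPr _) ?(leqW nk)// subSn// -natr1 addrA ltrDl.
- apply/seteqP; split => w.
    move=> ws k kn; apply: ws; rewrite tE// -ms mem_nth//.
    by rewrite -(prednK sz) ltnS.
  move=> ws u; rewrite -ms => /(nthP 0)[k ks <-].
  have kn : (k <= (size s').-1)%N by rewrite -ltnS prednK.
  by have := ws k kn; rewrite tE.
Qed.

End cylinders.

Section markov.
Context {R : realType} {m : nat}.
Variables (B : 'M[R]_m.+1) (P : probability (Omega R m) R).
Hypothesis P_markov : markov_chain B P.
Hypothesis P_start : forall i : 'I_m.+1, (0 < P (Omega_at i))%E.
Local Notation trans h := (expmx ((- h) *: B)).

Lemma cond_probE i A :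
  cond_prob P i A = (P (A `&` Omega_at i) * ((fine (P (Omega_at i)))^-1)%:E)%E.
Proof.
rewrite /cond_prob /= /mnormalize /= /mrestr setTI ifF//.
apply/negbTE; rewrite negb_or gt_eqF//= lt_eqF//.
by apply: (le_lt_trans (probability_le1 _ (measurable_Omega_at i))); exact: ltry.
Qed.

Lemma markov_path_prob (n : nat) (t : nat -> R) (j : nat -> 'I_m.+1) :
  0 <= t 0%N -> (forall k, t k < t k.+1) ->
  P [set w : cadlag R m | forall k, (k <= n)%N -> w (t k) = j k] =
  (P [set w : cadlag R m | w (t 0%N) = j 0%N] *
   (\prod_(k < n) trans (t k.+1 - t k) (j k) (j k.+1))%:E)%E.
Proof.
move=> t0 tS; elim: n => [|n IH].
  rewrite big_ord0 mule1; congr (P _); apply/seteqP; split => w /=.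
    by apply.
  by move=> h k; rewrite leqn0 => /eqP ->.
by rewrite P_markov// IH big_ord_recr/= EFinM muleA.
Qed.

Lemma Omega_at_mulV i :
  (P (Omega_at i) * ((fine (P (Omega_at i)))^-1)%:E = 1)%E.
Proof.
have f := fin_num_measure P _ (measurable_Omega_at i).
rewrite -[X in (X * _)%E](fineK f) -EFinM divff//.
by rewrite gt_eqF// fine_gt0// P_start ltey_eq f.
Qed.

Lemma cond_prob_Omega_at i : cond_prob P i (Omega_at i) = 1%E.
Proof. by rewrite cond_probE setIid Omega_at_mulV. Qed.

Lemma cond_prob_eval (h : R) (i j : 'I_m.+1) : 0 < h ->
  cond_prob P i [set w : cadlag R m | w h = j] = (trans h i j)%:E.
Proof.
move=> h0; rewrite cond_probE.
pose t (k : nat) := k%:R * h; pose ij (k : nat) := if k is 0%N then i else j.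
have t0 : 0 <= t 0%N by rewrite /t mul0r.
have tS k : t k < t k.+1 by rewrite ltr_pM2r// ltr_nat.
have := markov_path_prob 1 ij t0 tS; rewrite big_ord1 /t mul0r mul1r subr0 /=.
rewrite (_ : mkset _ = [set w : cadlag R m | w h = j] `&` Omega_at i); last first.
  apply/seteqP; split => w /=.
    move=> hw; split; first by have := hw 1%N isT; rewrite mul1r.
    by have := hw 0%N isT; rewrite mul0r.
  by move=> [w1 w0] [_|[_|//]]; rewrite ?mul0r ?mul1r.
move=> ->; have := cond_prob_Omega_at i; rewrite cond_probE setIid => e.
by rewrite muleAC e mul1e.
Qed.

(** Nonnegativity and the row sums are read off the conditional law of the state at time [h], whose
    weights form row [i] of the exponential. *)
Lemma trans_ge0 (h : R) i j : 0 < h -> 0 <= trans h i j.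
Proof. by move=> h0; rewrite -lee_fin -cond_prob_eval. Qed.

Lemma trans_sum1 (h : R) i : 0 < h -> \sum_j trans h i j = 1.
Proof.
move=> h0; apply: EFin_inj; rewrite -sumEFin.
under eq_bigr do rewrite -cond_prob_eval//.
rewrite -measure_bigsetU_ord//=.
- rewrite -bigcup_mkord_ord (_ : bigcup _ _ = setT) ?probability_setT//.
  by apply/seteqP; split => // w _; exists (w h : nat) => //=; rewrite inord_val.
- by move=> j; exact: measurable_eval.
- by move=> j k _ _ [w [/= <- <-]].
Qed.

Section shift_law.
Variables (h : R) (h_gt0 : 0 < h).
Let theta := @shift_path R m h (ltW h_gt0).

(** Both sides are measures in [A], and they agree on cylinders, where the path formula turns each
    into the same product of transition probabilities. This is the Markov property as an identity
    between laws on path space. *)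
Lemma shift_law i (A : set (Omega R m)) : measurable A ->
  cond_prob P i (theta @^-1` A) = (\sum_j (trans h i j)%:E * cond_prob P j A)%E.
Proof.
move=> mA.
have [m1 m1E] : exists m1 : {measure set (Omega R m) -> \bar R},
    m1 = pushforward (cond_prob P i) theta :> (set _ -> \bar R).
  by unshelve eexists (pushforward (cond_prob P i) theta); first exact: measurable_shift_path.
pose p j : {nonneg R} := NngNum (trans_ge0 i j h_gt0).
pose m2 : {measure set (Omega R m) -> \bar R} :=
  msum (fun k => mscale (p (inord k)) (cond_prob P (inord k))) m.+1.
have m2E D : m2 D = (\sum_j (trans h i j)%:E * cond_prob P j D)%E.
  by rewrite /m2 /msum /=; apply: eq_bigr => j _; rewrite inord_val.
suff : m1 A = m2 A by rewrite m1E m2E.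
apply: (measure_unique cylinders (fun k => cylinder [:: 0] (cst (inord k)))) => //.
- exact: cylinders_generate.
- exact: setI_closed_cylinders.
- move=> k; right; exists [:: 0], (cst (inord k)).
  by split; rewrite ?inE// => t; rewrite inE => /eqP ->.
- apply/seteqP; split => // w _; exists ((w : cadlag R m) 0 : nat) => // t.
  by rewrite inE => /eqP ->; rewrite inord_val.
- move=> _ [->|[s [a [s0 sp ->]]]]; first by rewrite !measure0.
  have [n [t [t0 tS cE]]] := cylinder_increasing a s0 sp.
  rewrite m1E m2E (bigD1 (a 0))//= big1 ?adde0; last first.
    move=> j ja; rewrite cond_probE (_ : _ `&` _ = set0) ?measure0 ?mul0e ?mule0//.
    by apply/seteqP; split => // w [ws w0]; move: ja; rewrite -(ws 0 s0) w0 eqxx.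
  have cO : cylinder s a `&` Omega_at (a 0) = cylinder s a.
    by apply/seteqP; split => w; [case|move=> ws; split => //; exact: ws].
  rewrite /pushforward !cond_probE cO {2}cE.
  rewrite (@markov_path_prob n t (a \o t)) ?t0// -/(Omega_at _).
  (* The event for the shifted path, together with the start at [i], is a cylinder for the original
     path with times [0, h + t 0, h + t 1, ...]. Since [t 0 = 0], its first transition is
     [trans h i (a 0)]. *)
  pose t' k := if k is k'.+1 then h + t k' else 0.
  pose j' k := if k is k'.+1 then a (t k') else i.
  have t'S k : t' k < t' k.+1.
    by case: k => [|k]; rewrite /t' ?t0 ?addr0// ltrD2l.
  have := @markov_path_prob n.+1 t' j' (lexx _) t'S.
  rewrite (_ : mkset _ = theta @^-1` cylinder s a `&` Omega_at i); last first.
    rewrite cE; apply/seteqP; split => w /=.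
      move=> ws; split; last exact: (ws 0%N).
      move=> k kn; rewrite -[LHS]/(theta w (t k)) shift_pathE; first exact: (ws k.+1).
      by elim: k {kn} => [|k IH]; [rewrite t0|rewrite (le_trans IH)// ltW].
    move=> [ws w0] [|k] kn //=; rewrite -ws//.
    rewrite -[RHS]/(theta w (t k)) shift_pathE//.
    by elim: k {kn} => [|k IH]; [rewrite t0|rewrite (le_trans IH)// ltW].
  rewrite -/(Omega_at i) => ->; rewrite big_ord_recl /= t0 addr0 subr0.
  set pr := \prod_(k < n) trans (t k.+1 - t k) _ _.
  rewrite (_ : \prod_(_ < n) _ = pr); last first.
    by apply: eq_bigr => k _; rewrite (_ : h + _ - _ = t k.+1 - t k)//; rewrite add0n /bump /= add1n; ring.
  by rewrite muleAC Omega_at_mulV mul1e muleAC Omega_at_mulV mul1e EFinM.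
- move=> k; rewrite m1E /pushforward.
  apply: (le_lt_trans (@probability_le1 _ _ _ (cond_prob P i) _ _)); last exact: ltry.
  have mt : measurable_fun setT theta := measurable_shift_path (ltW h_gt0).
  rewrite -[X in measurable X]setTI; apply: mt => //; exact: measurable_cylinder.
Qed.

(** A change of variables under the shift, then integration against a finite sum of scaled measures.
    Nonnegativity of [F] avoids any integrability condition, which is why costs are shifted
    beforehand. *)
Lemma integral_shift i (F : Omega R m -> \bar R) : measurable_fun setT F ->
  (forall w, (0 <= F w)%E) ->
  (\int[cond_prob P i]_w F (theta w) =
   \sum_j (trans h i j)%:E * \int[cond_prob P j]_w F w)%E.
Proof.
move=> mF F0.
pose p j : {nonneg R} := NngNum (trans_ge0 i j h_gt0).
pose mu k : {measure set (Omega R m) -> \bar R} := mscale (p (inord k)) (cond_prob P (inord k)).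
pose m2 : {measure set (Omega R m) -> \bar R} := msum mu m.+1.
have mt : measurable_fun setT theta := measurable_shift_path (ltW h_gt0).
have -> : (\int[cond_prob P i]_w F (theta w) =
    \int[pushforward (cond_prob P i) theta]_w F w)%E.
  by rewrite (ge0_integral_pushforward mt)// => ? _; exact: F0.
rewrite (eq_measure_integral m2)//; last first.
  move=> A mA _; transitivity (cond_prob P i (theta @^-1` A)) => //.
  rewrite (shift_law i mA); apply: eq_bigr => j _.
  by rewrite /mu /mscale /= inord_val.
rewrite ge0_integral_measure_sum//; apply: eq_bigr => j _.
by rewrite ge0_integral_mscale//= inord_val.
Qed.

End shift_law.

(** The complement of [Omega_at i] is null for [cond_prob P i]. This identifies the cost of a
    selected curve with that of the curve attached to the state [i]. *)
Lemma integral_cond_prob_eq i (F G : Omega R m -> \bar R) :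
  measurable_fun setT F -> measurable_fun setT G ->
  (forall w, (w : cadlag R m) 0 = i -> F w = G w) ->
  (\int[cond_prob P i]_w F w = \int[cond_prob P i]_w G w)%E.
Proof.
move=> mF mG FG; apply: ae_eq_integral => //.
exists (~` Omega_at i); split.
- by apply: measurableC; exact: measurable_Omega_at.
- have := cond_probE i (~` Omega_at i); rewrite setICl measure0 mul0e; exact.
- by move=> w /= h0 wi; apply: h0 => _; exact: FG.
Qed.

End markov.

(** * Joint measurability and the action *)

Lemma max0_sub (R : realDomainType) (s r : R) : s <= r ->
  0 <= Num.max r 0 - Num.max s 0 <= r - s.
Proof.
by move=> sr; apply/andP; have [s0|s0] := leP s 0; have [r0|r0] := leP r 0; split; lra.
Qed.

Lemma max0_lipschitz (R : realDomainType) (s r : R) :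
  `|Num.max s 0 - Num.max r 0| <= `|s - r|.
Proof.
wlog sr : s r / s <= r.
  by move=> wh; have [/wh//|/ltW/wh] := leP s r; rewrite distrC [leRHS]distrC.
have /andP[h1 h2] := max0_sub sr.
by rewrite distrC ger0_norm// [leRHS]distrC (ger0_norm (x := r - s)) ?subr_ge0.
Qed.

Lemma continuous_max0 (R : realType) (V : topologicalType) (f : R -> V) :
  {within `[0, +oo[, continuous f} -> continuous (fun s : R => f (Num.max s 0)).
Proof.
move=> /subspace_continuousP cf s.
have m0 (r : R) : (`[0, +oo[%classic : set R) (Num.max r 0).
  by rewrite /= in_itv /= andbT le_max lexx orbT.
apply: cvg_comp (cf _ (m0 s)) => A [e /= e0 eA].
apply/nbhs_ballP; exists e => //= r rs; apply: eA; last exact: m0.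
apply: le_lt_trans rs => /=.
exact: max0_lipschitz.
Qed.

Section joint_measurability.
Context {d : measure_display} {T : measurableType d} {R : realType}.

(* The values of [f w] at the grid points [(k + 1) / (n + 1)] converge to [f w]
   from the right. *)
Lemma measurable_right_continuous (f : T -> R -> R) :
  (forall s, measurable_fun setT (f^~ s)) ->
  (forall w s, f w r @[r --> s^'+] --> f w s) ->
  measurable_fun setT (fun z : T * R => f z.1 z.2).
Proof.
move=> mf rf.
pose r (n : nat) (s : R) : R := ((Num.floor (n.+1%:R * s) + 1)%:~R) / n.+1%:R.
have n0 n : 0 < n.+1%:R :> R by rewrite ltr0n.
have r_gt n s : s < r n s.
  by rewrite /r ltr_pdivlMr// mulrC; case/andP: (floor_itv (n.+1%:R * s)).
have r_le n s : r n s <= s + n.+1%:R^-1.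
  rewrite /r intrD mulrDl mul1r lerD2r ler_pdivrMr// [s * _]mulrC.
  by case/andP: (floor_itv (n.+1%:R * s)).
apply: (@measurable_fun_cvg _ _ _ _ (fun n z => f z.1 (r n z.2))) => [n|z _].
  move=> _ Y mY; rewrite setTI.
  (* In time the approximation is constant on each cell between consecutive multiples of
     [n.+1%:R^-1], so the preimage is a countable union of rectangles. *)
  rewrite (_ : _ @^-1` Y = \bigcup_(k in [set: int])
    (((f^~ ((k + 1)%:~R / n.+1%:R)) @^-1` Y) `*`
     `[k%:~R / n.+1%:R, (k + 1)%:~R / n.+1%:R[%classic)); last first.
    apply/seteqP; split => -[w s] /=.
      move=> Yr; exists (Num.floor (n.+1%:R * s)) => //; split => //=.
      rewrite in_itv /= ler_pdivrMr// ltr_pdivlMr// ![s * _]mulrC.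
      exact: floor_itv.
    move=> [k _ [/= Yw]]; rewrite in_itv /= ler_pdivrMr// ltr_pdivlMr// ![s * _]mulrC => ks.
    by rewrite /r (floor_def ks).
  apply: countable_bigcupT_measurable => // k; apply: measurableX => //.
  by rewrite -[X in measurable X]setTI; apply: mf.
have := rf z.1 z.2; move/cvg_at_rightP; apply; split => //.
apply: (@squeeze_cvgr _ _ _ _ (cst z.2) (fun n => z.2 + n.+1%:R^-1)).
- by apply: nearW => n; rewrite r_le (ltW (r_gt _ _)).
- exact: cvg_cst.
- rewrite -[X in _ --> X]addr0; apply: cvgD; first exact: cvg_cst.
  exact: cvg_harmonic.
Qed.

Lemma measurable_continuous_max0 (f : T -> R -> R) :
  (forall w, {within `[0, +oo[, continuous (f w)}) ->
  (forall s, 0 <= s -> measurable_fun setT (f^~ s)) ->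
  measurable_fun setT (fun z : T * R => f z.1 (Num.max z.2 0)).
Proof.
move=> cf mf; apply: (@measurable_right_continuous (fun w s => f w (Num.max s 0))).
  by move=> s; apply: mf; rewrite le_max lexx orbT.
by move=> w s; apply: cvg_at_right_filter; exact: continuous_max0.
Qed.

End joint_measurability.

(* Restricting the Cauchy criterion to rational increments leaves countably many
   conditions, so that the set of differentiability points is measurable. *)
Lemma cvg_dnbhs0_ratP (R : realType) (q : R -> R) (r : R) : 0 < r ->
  (forall h, 0 < `|h| < r -> {for h, continuous q}) ->
  cvg (q h @[h --> 0^']) <->
  forall n : nat, exists j : nat, j.+1%:R^-1 < r /\ forall h : rat,
    0 < `|ratr h : R| < j.+1%:R^-1 -> `|q (ratr h) - q j.+2%:R^-1| <= n.+1%:R^-1.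
Proof.
move=> r0 cq; split => [/cvg_ex[l ql] n|hq].
  have e0 : 0 < n.+1%:R^-1 / 2 :> R by rewrite divr_gt0// invr_gt0.
  have /cvgrPdist_lt/(_ _ e0)[e /= e_gt0 he] := ql.
  have me0 : 0 < Num.min e r by rewrite lt_min e_gt0.
  have [j _ hj] := (@cvgr0Pnorm_lt _ _ _ _ _ _).1 (@cvg_harmonic R) _ me0.
  have := hj j (leqnn _); rewrite /= /harmonic ger0_norm ?invr_ge0// lt_min => /andP[je jr].
  exists j; split => // h /andP[h0 hh].
  have hl x : 0 < `|x| < j.+1%:R^-1 -> `|l - q x| < n.+1%:R^-1 / 2.
    move=> /andP[x0 xj]; apply: he => /=; last by rewrite -normr_gt0.
    by rewrite sub0r normrN (lt_trans xj).
  have h1 := hl _ (introT andP (conj h0 hh)).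
  have h2 : `|l - q j.+2%:R^-1| < n.+1%:R^-1 / 2.
    apply: hl; rewrite ger0_norm ?invr_ge0// invr_gt0 ltr0n /=.
    by rewrite ltf_pV2 ?posrE ?ltr0n// ltr_nat.
  rewrite (_ : _ - _ = (l - q j.+2%:R^-1) - (l - q (ratr h))); last by ring.
  apply: le_trans (ler_normB _ _) _; rewrite [leRHS]splitr.
  exact: lerD (ltW h2) (ltW h1).
apply: cauchy_cvg; apply: cauchy_exP => e e0.
have [n _ hn] := (@cvgr0Pnorm_lt _ _ _ _ _ _).1 (@cvg_harmonic R) _ e0.
have := hn n (leqnn _); rewrite /= /harmonic ger0_norm ?invr_ge0// => ne.
have [j [jr hj]] := hq n.
(* The increment [j.+2%:R^-1] is a nonzero rational below [j.+1%:R^-1]; the value of [q] there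
   serves as centre of the Cauchy ball. *)
exists (q j.+2%:R^-1).
exists (j.+1%:R^-1) => /=; first by rewrite invr_gt0.
move=> h /=; rewrite sub0r normrN => hjj h0.
rewrite /ball /= distrC; apply: le_lt_trans ne.
have hr : 0 < `|h| < r by rewrite normr_gt0 h0 (lt_trans hjj).
apply/ler_addgt0Pr => e' e'0.
have /cvgrPdist_lt/(_ _ e'0)/nbhs_ballP[t /= t0 ht] := cq h hr.
(* A rational this close to [h] is nonzero and still below [j.+1%:R^-1] in absolute value, and [q]
   varies by less than [e'] between the two. *)
pose t' := Num.min t (Num.min `|h| (j.+1%:R^-1 - `|h|)).
have t'0 : 0 < t' by rewrite !lt_min t0 normr_gt0 h0 subr_gt0.
have [x] : exists x : rat, ratr x \in `](h - t'), (h + t')[.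
  by apply: rat_in_itvoo; lra.
rewrite in_itv /= => /andP[x1 x2].
have xt : `|h - ratr x| < t' by rewrite ltr_norml; apply/andP; split; lra.
move: (xt); rewrite !lt_min => /and3P[xt1 xt2 xt3].
have qx : `|q h - q (ratr x)| < e' by apply: ht.
have xx : 0 < `|ratr x : R| < j.+1%:R^-1.
  have h1 := lerB_dist h (ratr x : R).
  have h2 := lerB_dist (ratr x : R) h; rewrite distrC in h2.
  apply/andP; split; last first.
    by have := le_lt_trans h2 xt3; rewrite ltrBlDr subrK.
  apply: lt_le_trans (_ : 0 < `|h| - `|h - ratr x|) _; first by rewrite subr_gt0.
  by rewrite lerBlDr -lerBlDl.
rewrite (_ : _ - _ = (q h - q (ratr x)) + (q (ratr x) - q j.+2%:R^-1)); last by ring.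
by apply: le_trans (ler_normD _ _) _; rewrite addrC lerD ?hj// ltW.
Qed.

Section measurable_derivative.
Context {d : measure_display} {T : measurableType d} {R : realType} {n : nat}.
Variable gamma : T -> R -> 'rV[R]_n.
Hypothesis gamma_cont : forall w, {within `[0, +oo[, continuous (gamma w)}.
Hypothesis gamma_meas : forall s k, 0 <= s -> measurable_fun setT (fun w => gamma w s 0 k).

Let coord_within w k : {within `[0, +oo[, continuous (fun s => gamma w s 0 k)}.
Proof.
move=> s; apply: (@cvg_comp _ _ _ (gamma w) (fun v : 'rV[R]_n => v 0 k) _ _ _ (@gamma_cont w s)).
exact: coord_continuous.
Qed.

Let coord_cont w k : continuous (fun u : R => gamma w (Num.max u 0) 0 k).
Proof. by apply: (@continuous_max0 _ _ (fun s => gamma w s 0 k)); exact: coord_within. Qed.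

(** Clamping both times at 0 keeps the quotient continuous in [h] away from 0; at a positive time it
    is the genuine difference quotient once [|h|] is smaller than that time. *)
Let quot (h : R) k (z : T * R) : R :=
  h^-1 * (gamma z.1 (Num.max (h + z.2) 0) 0 k - gamma z.1 (Num.max z.2 0) 0 k).

Let measurable_quot h k : measurable_fun setT (quot h k).
Proof.
have mg : measurable_fun setT (fun z : T * R => gamma z.1 (Num.max z.2 0) 0 k).
  apply: (@measurable_continuous_max0 _ _ _ (fun w s => gamma w s 0 k)).
    by move=> w; exact: coord_within.
  by move=> s s0; exact: gamma_meas.
apply: measurable_funM => //; apply: measurable_funB => //.
have mh : measurable_fun setT (fun z : T * R => (z.1, h + z.2)).
  apply: measurable_fun_pair; first exact: measurable_fst.
  by apply: measurable_funD => //; exact: measurable_snd.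
exact: (measurableT_comp mg mh).
Qed.

Let pos : set (T * R) := setT `*` `]0, +oo[%classic.
Let diffpts : set (T * R) :=
  pos `&` [set z | forall k, cvg (quot h k z @[h --> 0^'])].

Let measurable_pos : measurable pos.
Proof. by apply: measurableX => //; exact: measurable_itv. Qed.

Let measurable_diffpts : measurable diffpts.
Proof.
pose E (i j : nat) (h : rat) k : set (T * R) :=
  [set z | 0 < `|ratr h : R| < j.+1%:R^-1 ->
    `|quot (ratr h) k z - quot j.+2%:R^-1 k z| <= i.+1%:R^-1].
have mE i j h k : measurable (E i j h k).
  have [hj|hj] := boolP (0 < `|ratr h : R| < j.+1%:R^-1); last first.
    rewrite (_ : E _ _ _ _ = setT); first exact: measurableT.
    by apply/seteqP; split => // z _; rewrite /E /= (negbTE hj).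
  rewrite (_ : E _ _ _ _ = setT `&`
      [set z | `|quot (ratr h) k z - quot j.+2%:R^-1 k z| <= i.+1%:R^-1]).
    apply: measurable_fun_le => //.
    by apply: measurableT_comp => //; apply: measurable_funB; exact: measurable_quot.
  by apply/seteqP; split => z /=; [move=> /(_ hj)|move=> [_ ? _]].
rewrite (_ : diffpts = pos `&` \big[setI/setT]_(k < n) \bigcap_i \bigcup_j
  ((setT `*` `]j.+1%:R^-1, +oo[%classic) `&` \bigcap_(h in [set: rat]) E i j h k)).
  apply: measurableI => //; apply: bigsetI_measurable => k _.
  apply: bigcapT_measurable => i; apply: bigcupT_measurable => j.
  apply: measurableI; first by apply: measurableX => //; exact: measurable_itv.
  rewrite -[X in measurable X]setCK setC_bigcap; apply: measurableC.
  by apply: bigcupT_measurable_rat => h; exact: measurableC.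
have key z k : pos z -> cvg (quot h k z @[h --> 0^']) <->
  (\bigcap_i \bigcup_j ((setT `*` `]j.+1%:R^-1, +oo[%classic) `&` \bigcap_(h in [set: rat]) E i j h k)) z.
  case: z => w s [_ /=]; rewrite in_itv /= andbT => s0.
  have qc h : 0 < `|h| < s -> {for h, continuous (fun h => quot h k (w, s))}.
    move=> /andP[h0 hs]; rewrite /quot /=.
    apply: (@continuousM R R (fun h : R => h^-1) (fun h : R =>
      gamma w (Num.max (h + s) 0) 0 k - gamma w (Num.max s 0) 0 k)).
      by apply: inv_continuous; rewrite -normr_gt0.
    apply: (@continuousB R R^o R (fun h : R => gamma w (Num.max (h + s) 0) 0 k)
      (cst (gamma w (Num.max s 0) 0 k))); last exact: cst_continuous.
    apply: (@continuous_comp _ _ _ (fun h : R => h + s) (fun u : R => gamma w (Num.max u 0) 0 k)).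
      apply: (@continuousD R R^o _ id (cst s)); [by move=> ?|exact: cst_continuous].
    exact: coord_cont.
  split=> [/(cvg_dnbhs0_ratP s0 qc) H i _|H].
    have [j [js hj]] := H i.
    exists j => //; split; first by split => //=; rewrite in_itv /= js.
    by move=> h _ /=; exact: hj.
  apply/(cvg_dnbhs0_ratP s0 qc) => i.
  have [j _ [[_ /=]]] := H i I; rewrite in_itv /= andbT => js hj.
  by exists j; split => // h; exact: (hj h I).
apply/seteqP; split => z [pz hz]; split => //.
  by elim/big_ind : _ => // k _; apply/(key z k pz); exact: hz.
move=> k; apply/(key z k pz); move: hz; rewrite (bigD1 k)//=; by case.
Qed.

Let near_quot k z : pos z -> \forall h \near (0 : R)^',
  (h^-1 *: (gamma z.1 (h + z.2) - gamma z.1 z.2)) 0 k = quot h k z.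
Proof.
case: z => w s [_ /=]; rewrite in_itv /= andbT => s0.
exists s => //= h /=; rewrite sub0r normrN ltr_norml => /andP[h1 _] _.
rewrite !mxE /quot /= max_l ?max_l ?(ltW s0)//; lra.
Qed.

Let diffpts_cvg z : diffpts z ->
  h^-1 *: (gamma z.1 (h + z.2) - gamma z.1 z.2) @[h --> (0 : R)^'] --> derive1 (gamma z.1) z.2.
Proof.
move=> [pz hz].
suff : cvg (h^-1 *: (gamma z.1 (h + z.2) - gamma z.1 z.2) @[h --> (0 : R)^']) by [].
apply/cvg_ex; exists (\row_k lim (quot h k z @[h --> 0^'])).
apply: cvg_matrix => i k; rewrite (ord1 i) mxE.
apply: cvg_trans (hz k); apply: near_eq_cvg.
by apply: filterS (near_quot k pz) => h <-.
Qed.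

Let diffpts_quot_cvg k z : diffpts z ->
  quot h k z @[h --> 0^'] --> derive1 (gamma z.1) z.2 0 k.
Proof.
move=> dz; have c := diffpts_cvg dz.
apply: cvg_trans (@cvg_comp _ _ _ _ (fun v : 'rV[R]_n => v 0 k) _ _ _ c (@coord_continuous _ _ _ _ _ _)).
by apply: near_eq_cvg; exact: (near_quot k dz.1).
Qed.

(** [lim] returns [point] when there is no limit, so [derive1] takes a single value at all positive
    times of non-differentiability. *)
Let derive1_out z : (pos `\` diffpts) z -> derive1 (gamma z.1) z.2 = point.
Proof.
move=> [pz ndz]; apply: dvgP => c; apply: ndz; split => // k.
apply/cvg_ex; exists (derive1 (gamma z.1) z.2 0 k).
apply: cvg_trans (@cvg_comp _ _ _ _ (fun v : 'rV[R]_n => v 0 k) _ _ _ c (@coord_continuous _ _ _ _ _ _)).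
by apply: near_eq_cvg; exact: (near_quot k pz).
Qed.

(** On the differentiability set the derivative is the limit of the quotients with increments
    [i.+1%:R^-1]; at the other positive times it is constant. *)
Lemma measurable_derive1_coord k :
  measurable_fun (setT `*` `]0, +oo[%classic : set (T * R))
    (fun z : T * R => (derive1 (gamma z.1) z.2) 0 k).
Proof.
rewrite -/pos -(setDUK (_ : diffpts `<=` pos)); last exact: subIsetl.
have mD : measurable (pos `\` diffpts) by apply: measurableD.
apply/measurable_funU => //; split.
  apply: (@measurable_fun_cvg _ _ _ _ (fun i z => quot i.+1%:R^-1 k z)) => [i|z dz].
    by apply: measurable_funS (measurable_quot _ _).
  move=> Q /(@diffpts_quot_cvg k z dz)[e /= e0 he].
  have [i _ hi] := (@cvgr0Pnorm_lt _ _ _ _ _ _).1 (@cvg_harmonic R) _ e0.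
  exists i => // l il; apply: he => /=; first by rewrite sub0r normrN; exact: hi.
  by rewrite invr_eq0 pnatr_eq0.
apply: (eq_measurable_fun (cst ((point : 'rV[R]_n) 0 k))) => //.
by move=> z /[!inE] zD; rewrite derive1_out.
Qed.

End measurable_derivative.

(** * Measurability of the Lagrangian along a random curve *)

Section measurable_action.
Context {R : realType} {N m : nat}.
Implicit Types (gamma : Omega R m -> R -> 'rV[R]_N.+1).

Lemma family_eval_continuous (s : R) : 0 <= s ->
  continuous (fun c : {family compact_Rplus, R -> 'rV[R]_N.+1} => c s).
Proof.
move=> s0 c.
have Ks : compact_Rplus [set s].
  by split; [exact: compact_set1|move=> _ ->; rewrite /= in_itv /= s0].
have := (fam_cvgP compact_Rplus c (nbhs_filter c)).1 cvg_id _ Ks.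
by rewrite uniform_set1.
Qed.

Lemma random_curve_measurable gamma (s : R) (phi : 'rV[R]_N.+1 -> R) :
  random_curve gamma -> 0 <= s -> continuous phi ->
  measurable_fun setT (fun w => phi (gamma w s)).
Proof.
move=> [_ mg] s0 cphi.
apply: (measurability _ (RGenOInfty.measurableE R)) => _ [_ [x ->] <-].
rewrite setTI -[X in measurable X]/(gamma @^-1`
  [set c : {family compact_Rplus, R -> 'rV[R]_N.+1} | (phi \o (fun c => c s)) c \in `]x, +oo[ ]).
apply: mg; apply: (@open_comp _ _ (phi \o (fun c : {family compact_Rplus, R -> 'rV[R]_N.+1} => c s)) `]x, +oo[%classic).
  move=> c _; apply: continuous_comp; first exact: family_eval_continuous.
  exact: cphi.
exact: interval_open.
Qed.

(** By right continuity of the paths, the indicator of the state [j] is right continuous in time;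
    being measurable in the path, it is jointly measurable. *)
Lemma measurable_state (j : 'I_m.+1) :
  measurable ([set z | (z.1 : cadlag R m) z.2 = j] : set (Omega R m * R)).
Proof.
have mI : measurable_fun setT (fun z : Omega R m * R => ((z.1 : cadlag R m) z.2 == j)%:R : R).
  apply: (@measurable_right_continuous _ _ _ (fun (w : Omega R m) s => ((w : cadlag R m) s == j)%:R)).
    move=> s; rewrite [X in measurable_fun _ X](_ : _ = \1_[set w : cadlag R m | w s = j]).
      by apply: measurable_indic; exact: measurable_eval.
    by apply/funext => w; rewrite indicE; case: eqP => we; [rewrite mem_set|rewrite memNset].
  move=> w s; apply: cvg_near_cst; have [s0|s0] := leP 0 s.
    by apply: filterS (cadlag_right w s0) => r ->.
  near=> r; have r0 : r < 0 by near: r; exact: nbhs_right_lt.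
  by rewrite (cadlag_neg w r0) (cadlag_neg w s0).
rewrite (_ : mkset _ = setT `&` (fun z : Omega R m * R => ((z.1 : cadlag R m) z.2 == j)%:R : R) @^-1` [set 1]).
  by apply: mI => //; exact: measurable_set1.
apply/seteqP; split => z /= => [->|[_]]; first by rewrite eqxx.
by case: eqP => // _ /esym/eqP; rewrite oner_eq0.
Unshelve. all: by end_near. Qed.

Lemma rat_vector_dense (p : 'rV[R]_N.+1) (U : set 'rV[R]_N.+1) : nbhs p U ->
  exists r : 'rV[rat]_N.+1, U (map_mx ratr r).
Proof.
move=> /nbhs_ballP[e /= e0 eU].
have ex (k : 'I_N.+1) : exists r : rat, ratr r \in `]p 0 k - e, p 0 k + e[.
  by apply: rat_in_itvoo; lra.
have [r hr] := choice ex.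
exists (\row_k r k); apply: eU; split => // i k; rewrite !mxE (ord1 i).
by have := hr k; rewrite in_itv /= /ball /= ltr_norml => /andP[h1 h2]; apply/andP; split; lra.
Qed.

Variables (H : 'I_m.+1 -> 'rV[R]_N.+1 -> 'rV[R]_N.+1 -> R).
Hypothesis H_unif : forall i, unif_cont_on_balls (H i).

Lemma hamiltonian_continuous_x i p : continuous (H i ^~ p).
Proof.
move=> x; apply/(@cvgrPdist_lt R R^o _ (nbhs x)) => e e0.
have r0 : 0 < enorm p + 1 by rewrite ltr_wpDl// enorm_ge0.
have [d d0 hd] := H_unif i r0 e0.
near=> y; apply: hd; rewrite ?ltrDl// ?subrr ?enorm0//.
by rewrite -opprB enormN; near: y; exact: nbhs_enorm.
Unshelve. all: by end_near. Qed.

(** By continuity of [H] in [p], a momentum that beats [y] can be moved to a rational one.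
    Superlevel sets of the Lagrangian thus become countable unions. *)
Lemma lagrangian_gtP i x q (y : \bar R) : (y < lagrangian H i x q)%E <->
  exists r : 'rV[rat]_N.+1, (y < (dotv (map_mx ratr r) q - H i x (map_mx ratr r))%:E)%E.
Proof.
split=> [|[r hr]]; last exact: lt_le_trans hr (lagrangian_ge _ _ _ _ _).
move=> /ereal_sup_gt[_ [p _ <-]] yp.
case: y yp => [y||]; last 2 first.
- by rewrite ltNge leey.
- by move=> _; exists 0; exact: ltNyr.
rewrite lte_fin => yp.
have c : (fun p => dotv p q - H i x p) @ p --> dotv p q - H i x p.
  apply: (@continuousB R R^o _ (dotv ^~ q) (H i x)); first exact: dotvl_continuous.
  exact: hamiltonian_continuous.
have U := cvgr_gt _ c _ yp.
by have [r hr] := rat_vector_dense (U (nbhs_filter p)); exists r; rewrite lte_fin.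
Qed.

Variable gamma : Omega R m -> R -> 'rV[R]_N.+1.
Hypothesis gamma_random : random_curve gamma.

Let D : set (Omega R m * R) := setT `*` `]0, +oo[%classic.

Let measurable_D : measurable D.
Proof. by apply: measurableX => //; exact: measurable_itv. Qed.

Lemma measurable_lagrangian_along :
  measurable_fun (setT `*` `]0, +oo[%classic : set (Omega R m * R))
    (fun z => lagrangian H ((z.1 : cadlag R m) z.2) (gamma z.1 z.2)
       (- derive1 (gamma z.1) z.2)).
Proof.
rewrite -/D => _; apply: (measurability _ (ErealGenOInfty.measurableE R)) => // _ [_ [y ->] <-].
(* The superlevel set is split over the current state [j] and over the rational momentum [r] that
   witnesses the inequality. *)
rewrite (_ : _ `&` _ = \bigcup_(jr in [set: 'I_m.+1 * 'rV[rat]_N.+1])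
  ((D `&` [set z | (z.1 : cadlag R m) z.2 = jr.1]) `&`
   (D `&` [set z | y < dotv (map_mx ratr jr.2) (- derive1 (gamma z.1) z.2) -
        H jr.1 (gamma z.1 (Num.max z.2 0)) (map_mx ratr jr.2)]))).
  apply: countable_bigcupT_measurable; [exact: countableP|move=> [j r] /=].
  apply: measurableI; first by apply: measurableI => //; exact: measurable_state.
  pose f (z : Omega R m * R) := dotv (map_mx ratr r) (- derive1 (gamma z.1) z.2) -
    H j (gamma z.1 (Num.max z.2 0)) (map_mx ratr r).
  have mf : measurable_fun D f.
    apply: measurable_funB.
      rewrite /dotv; apply: measurable_sum => k; apply: measurable_funM => //.
      apply: (eq_measurable_fun (fun z => - derive1 (gamma z.1) z.2 0 k)).
        by move=> z _; rewrite mxE.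
      apply: measurableT_comp => //; apply: measurable_derive1_coord.
        exact: gamma_random.1.
      move=> s l s0; apply: (@random_curve_measurable gamma s (fun v => v 0 l)) => //.
      exact: coord_continuous.
    apply: (measurable_funS measurableT) => //.
    apply: (@measurable_continuous_max0 _ _ _ (fun w s => H j (gamma w s) (map_mx ratr r))).
      move=> w s; apply: (@cvg_comp _ _ _ (gamma w) (H j ^~ (map_mx ratr r)) _ _ _ (gamma_random.1 w s)).
      exact: hamiltonian_continuous_x.
    move=> s s0; apply: (@random_curve_measurable gamma s (H j ^~ (map_mx ratr r))) => //.
    exact: hamiltonian_continuous_x.
  by have := mf measurable_D `]y, +oo[%classic (measurable_itv _); congr measurable;
     apply/seteqP; split => z [Dz /=]; rewrite in_itv /= andbT.
apply/seteqP; split => -[w s].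
  move=> [[_ /= s0]]; rewrite in_itv /= andbT => /lagrangian_gtP[r hr].
  exists ((w : cadlag R m) s, r) => //=; split; first by split.
  by split; [split|move: s0; rewrite in_itv /= andbT => s0; rewrite max_l ?(ltW s0)].
move=> [[j r] _ [/= [[_ s0] /= ws] [_ /= hr]]]; split; first by split.
rewrite /= in_itv /= andbT; apply/lagrangian_gtP; exists r.
by move: s0 hr; rewrite /= in_itv /= andbT ws => s0; rewrite max_l ?(ltW s0).
Qed.



End measurable_action.

(** [f] may have infinite integral, so the claim is derived from the equality
    [(f + c) + f^- = f^+ + c] between nonnegative functions; [f^- <= c] has finite integral and can
    be subtracted. *)
Lemma integral_lower_bounded_shift d (T : measurableType d) (R : realType)
    (mu : {measure set T -> \bar R}) (D : set T) (f : T -> \bar R) (c : R) :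
  measurable D -> (mu D < +oo)%E -> measurable_fun D f -> 0 <= c ->
  (forall x, D x -> ((- c)%:E <= f x)%E) ->
  (\int[mu]_(x in D) (f x + c%:E) = \int[mu]_(x in D) f x + c%:E * mu D)%E.
Proof.
move=> mD muD mf c0 fc.
have neg_le x : D x -> (f^\- x <= c%:E)%E.
  move=> Dx; rewrite funenegE ge_max lee_fin c0 andbT leeNl.
  exact: fc.
have mneg : measurable_fun D (f^\-)%E by exact: measurable_funeneg.
have mpos : measurable_fun D (f^\+)%E by exact: measurable_funepos.
have If : (\int[mu]_(x in D) f^\- x)%E \is a fin_num.
  rewrite ge0_fin_numE; last by apply: integral_ge0 => x _; exact: funeneg_ge0.
  apply: le_lt_trans (_ : (\int[mu]_(x in D) c%:E < +oo))%E; last first.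
    by rewrite integral_cst// lte_mul_pinfty// lee_fin.
  by apply: ge0_le_integral.
have g0 x : D x -> (0 <= f x + c%:E)%E.
  by move=> Dx; have := leeD2r c%:E (fc x Dx); rewrite -EFinD addNr.
have E : (\int[mu]_(x in D) (f x + c%:E) + \int[mu]_(x in D) f^\- x =
          \int[mu]_(x in D) f^\+ x + c%:E * mu D)%E.
  rewrite -ge0_integralD//; last exact: (emeasurable_funD mf (measurable_cst _)).
  rewrite -[(c%:E * _)%E]integral_cst// -ge0_integralD//.
    apply: eq_integral => x /[!inE] Dx.
    have fE := congr1 (@^~ x) (funeposneg f).
    rewrite [X in (X + _ + _)%E]fE addeAC; congr (_ + _)%E.
    rewrite subeK// ge0_fin_numE ?funeneg_ge0//.
    exact: le_lt_trans (neg_le x Dx) (ltry _).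
rewrite [in RHS]integralE addeAC -E addeK//.
Qed.

(** * Translation invariance of the Lebesgue measure *)

Section translation.
Context {R : realType}.
Local Notation mu := (@lebesgue_measure R).

Lemma measurable_translation (h : R) : measurable_fun setT (fun x : R => x - h).
Proof. by apply: measurable_funB. Qed.

Lemma lebesgue_measure_translation (h : R) (A : set R) : measurable A ->
  mu ((fun x => x - h) @^-1` A) = mu A.
Proof.
move=> mA.
pose t (x : measurableTypeR R) : measurableTypeR R := x - h.
have mt : measurable_fun [set: measurableTypeR R] t := measurable_translation h.
have [m1 m1E] : exists m1 : {measure set (measurableTypeR R) -> \bar R},
    m1 = pushforward mu t :> (set _ -> \bar R).
  by unshelve eexists (pushforward mu t); first exact: mt.
rewrite -[LHS]/(pushforward mu t A) -m1E; symmetry.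
apply: lebesgue_measure_unique => // _ [[a b] /= ab <-].
rewrite m1E /pushforward /t.
rewrite (_ : _ @^-1` _ = `]a + h, b + h]%classic); last first.
  by apply/seteqP; split => x /=; rewrite !in_itv /= ltrBrDr lerBlDr.
rewrite !lebesgue_measure_itv /= !lte_fin ltrD2r; case: ifP => // _.
by rewrite -!EFinB; congr EFin; ring.
Qed.

Lemma ge0_integral_translation (h a b : R) (f : R -> \bar R) :
  measurable_fun `]a, b] f -> (forall x, x \in `]a, b] -> (0 <= f x)%E) ->
  (\int[mu]_(x in `]a, b]) f x = \int[mu]_(x in `](a + h)%R, (b + h)%R]) f (x - h)%R)%E.
Proof.
move=> mf f0.
have mt : measurable_fun [set: measurableTypeR R] (fun x : measurableTypeR R => x - h : measurableTypeR R).
  exact: measurable_translation.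
rewrite [RHS](_ : _ = \int[mu]_(x in (fun x : R => (x - h)%R) @^-1` `]a, b]%classic) (f \o (fun x : R => (x - h)%R)) x)%E; last first.
  congr (integral _ _ _); apply/seteqP.
  by split => x /=; rewrite !in_itv /= ltrBrDr lerBlDr.
rewrite -(ge0_integral_pushforward mt)//.
- by apply: eq_measure_integral => A mA _; symmetry; exact: lebesgue_measure_translation.
- by move=> x /[!inE]; exact: f0.
Qed.

Lemma lebesgue_measure_0t (t : R) : 0 <= t -> mu `]0, t]%classic = t%:E.
Proof.
move=> t0; rewrite lebesgue_measure_itv /= lte_fin; case: ltP => t0'.
  by rewrite -EFinB subr0.
by congr EFin; apply/eqP; rewrite eq_le t0 t0'.
Qed.

End translation.

Section action_measurability.
Context {R : realType} {N m : nat}.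
Variables (H : 'I_m.+1 -> 'rV[R]_N.+1 -> 'rV[R]_N.+1 -> R).
Hypothesis H_unif : forall i, unif_cont_on_balls (H i).
Variables (K : R).
Hypothesis K_ge0 : 0 <= K.
Hypothesis L_lower : forall i x q, ((- K)%:E <= lagrangian H i x q)%E.
Variable gamma : Omega R m -> R -> 'rV[R]_N.+1.
Hypothesis gamma_random : random_curve gamma.
Local Notation mu := (@lebesgue_measure R).

Definition lagrangian_along (w : Omega R m) (s : R) : \bar R :=
  lagrangian H ((w : cadlag R m) s) (gamma w s) (- derive1 (gamma w) s).

Let D : set (Omega R m * R) := setT `*` `]0, +oo[%classic.
(** Adding [K] makes the Lagrangian nonnegative and extension by zero makes it a function on the
    whole product, the form in which Tonelli applies. *)
Let G : Omega R m * R -> \bar R := (fun z => lagrangian_along z.1 z.2 + K%:E)%E \_ D.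

Let measurable_D : measurable D.
Proof. by apply: measurableX => //; exact: measurable_itv. Qed.

Let lagrangian_shift_ge0 w s : (0 <= lagrangian_along w s + K%:E)%E.
Proof. by have := leeD2r K%:E (L_lower _ _ _); rewrite -EFinD addNr; apply. Qed.

Let G_ge0 z : (0 <= G z)%E.
Proof. by rewrite /G patchE; case: ifP => // _; exact: lagrangian_shift_ge0. Qed.

Let measurable_G : measurable_fun setT G.
Proof.
have mL : measurable_fun D (fun z => lagrangian_along z.1 z.2).
  exact: measurable_lagrangian_along.
have mLK : measurable_fun D (fun z => lagrangian_along z.1 z.2 + K%:E)%E.
  exact: (emeasurable_funD mL (measurable_cst K%:E)).
exact: (iffLR (measurable_restrictT _ measurable_D) mLK).
Qed.

Lemma measurable_lagrangian_path w (t : R) :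
  measurable_fun `]0, t] (lagrangian_along w).
Proof.
have mI : measurable (`]0, t]%classic : set R) by exact: measurable_itv.
have mw : measurable_fun setT (fun s : R => (w, s)) by exact: measurable_pair1.
have m1 : measurable_fun `]0, t] (fun s => G (w, s) - K%:E)%E.
  apply: emeasurable_funB => //; apply: (measurable_funS measurableT) => //.
  exact: (measurableT_comp measurable_G mw).
apply: (eq_measurable_fun _ _ m1) => s /[!inE] /=; rewrite in_itv /= => /andP[s0 _].
by rewrite /G patchE mem_set ?addeK//; split => //=; rewrite in_itv /= s0.
Qed.

(** Measurability is known at positive times only, the two-sided derivative at 0 involving negative
    times; the endpoint is negligible. *)
Lemma integral_lagrangian_closed w (t : R) :
  (\int[mu]_(s in `[0%R, t]) lagrangian_along w s =
   \int[mu]_(s in `]0%R, t]) lagrangian_along w s)%E.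
Proof. by rewrite integral_itv_obnd_cbnd//; exact: measurable_lagrangian_path. Qed.

Lemma integral_lagrangian_shift w (t : R) : 0 <= t ->
  (\int[mu]_(s in `]0%R, t]) (lagrangian_along w s + K%:E) =
   \int[mu]_(s in `[0%R, t]) lagrangian_along w s + (K * t)%:E)%E.
Proof.
move=> t0; rewrite integral_lagrangian_closed integral_lower_bounded_shift//.
- by rewrite EFinM; congr (_ + _ * _)%E; exact: lebesgue_measure_0t.
- by rewrite [X in (X < _)%E](lebesgue_measure_0t t0) ltry.
- exact: measurable_lagrangian_path.
- by move=> s _; exact: L_lower.
Qed.

Let measurable_running_cost (t : R) : measurable_fun setT
  (fun w => \int[mu]_(s in `]0%R, t]) (lagrangian_along w s + K%:E))%E.
Proof.
pose D' : set (Omega R m * R) := setT `*` `]0, t]%classic.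
have mD' : measurable D' by apply: measurableX => //; exact: measurable_itv.
have mGt : measurable_fun setT (G \_ D').
  have mGD : measurable_fun D' G by apply: (measurable_funS _ _ measurable_G).
  exact: (iffLR (measurable_restrictT _ mD') mGD).
have Gt0 z : (0 <= (G \_ D') z)%E by rewrite patchE; case: ifP.
have := @measurable_fun_fubini_tonelli_F _ _ _ _ _ mu _ mGt Gt0.
congr (measurable_fun setT _); apply/funext => w.
rewrite /fubini_F [RHS]integral_mkcond; apply: eq_integral => s _.
rewrite !patchE; have -> : ((w, s) \in D') = (s \in `]0, t]%classic).
  by apply/idP/idP => [/set_mem[_ /=]|/set_mem ?]; [move=> ?|]; apply/mem_set.
case: ifP => //; rewrite inE /= in_itv /= => /andP[s0 _].
by rewrite /G patchE mem_set//; split => //=; rewrite in_itv /= s0.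
Qed.

Variables (u0 : 'rV[R]_N.+1 -> 'cV[R]_m.+1) (M : R).
Hypothesis u0_cont : continuous u0.
Hypothesis M_ge0 : 0 <= M.
Hypothesis u0_bound : forall x i, `|u0 x i 0| <= M.

Let measurable_terminal (t : R) : 0 <= t -> measurable_fun setT
  (fun w : Omega R m => u0 (gamma w t) ((w : cadlag R m) t) 0).
Proof.
move=> t0; rewrite (_ : (fun w => _) = fun w : Omega R m =>
    \sum_(j < m.+1) \1_[set w : cadlag R m | w t = j] w * u0 (gamma w t) j 0).
  apply: measurable_sum => j; apply: measurable_funM.
    by apply: measurable_indic; exact: measurable_eval.
  apply: (@random_curve_measurable _ _ _ gamma t (fun x => u0 x j 0)) => // x.
  apply: (@continuous_comp _ _ _ u0 (fun v => v j 0)); first exact: u0_cont.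
  exact: coord_continuous.
apply/funext => w; rewrite (bigD1 ((w : cadlag R m) t))//= big1 ?addr0.
  by rewrite indicE mem_set// mul1r.
by move=> j jw; rewrite indicE memNset ?mul0r//= => wj; rewrite wj eqxx in jw.
Qed.

Lemma action_shift t w : 0 <= t ->
  (action H u0 t gamma w + (K * t)%:E = (u0 (gamma w t) (w t) 0)%:E +
   \int[mu]_(s in `]0%R, t]) (lagrangian_along w s + K%:E))%E.
Proof. by move=> t0; rewrite /action -addeA -integral_lagrangian_shift. Qed.

Lemma action_ge t w : 0 <= t -> ((- (M + K * t))%:E <= action H u0 t gamma w)%E.
Proof.
move=> t0; have := integral_lagrangian_shift w t0.
have : (0 <= \int[mu]_(s in `]0%R, t]) (lagrangian_along w s + K%:E))%E.
  by apply: integral_ge0 => s _; exact: lagrangian_shift_ge0.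
move=> /[swap] -> h.
rewrite opprD EFinD /action; apply: leeD.
  by rewrite lee_fin; have := u0_bound (gamma w t) ((w : cadlag R m) t); rewrite ler_norml => /andP[].
by rewrite EFinN -sub0e leeBlDr.
Qed.

Lemma measurable_action t : 0 <= t -> 
  measurable_fun setT (action H u0 t gamma : Omega R m -> \bar R).
Proof.
move=> t0; rewrite (_ : action _ _ _ _ = (fun w => (u0 (gamma w t) ((w : cadlag R m) t) 0)%:E +
   (\int[mu]_(s in `]0%R, t]) (lagrangian_along w s + K%:E) - (K * t)%:E))%E).
  apply: emeasurable_funD; first by apply/measurable_EFinP; exact: measurable_terminal.
  by apply: emeasurable_funB; [exact: measurable_running_cost|exact: measurable_cst].
apply/funext => w; rewrite /action integral_lagrangian_shift// addeK//.
Qed.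

End action_measurability.

(** * Restarting admissible curves *)

Lemma near_fmap_eq (T U : Type) (F : set_system T) (f g : T -> U) : Filter F ->
  {near F, f =1 g} -> f @ F = g @ F.
Proof.
move=> FF fg; apply/seteqP; split => A; rewrite /fmap /=; apply: filterS2 fg => x.
  by move=> /= ->.
by move=> /= ->.
Qed.

Section select.
Context {R : realType} {N m : nat}.
Variable eta : 'I_m.+1 -> Omega R m -> R -> 'rV[R]_N.+1.
Hypothesis eta_adm : forall j, admissible (eta j).

(* The initial state takes finitely many values, so gluing one curve per state
   needs no measurable selection. *)
Definition select_curve (w : Omega R m) := eta ((w : cadlag R m) 0) w.

Lemma admissible_select : admissible select_curve.
Proof.
split.
- split=> [w|O oO]; first by have [[c _] _ _] := eta_adm ((w : cadlag R m) 0); exact: c.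
  rewrite (_ : _ @^-1` _ = \bigcup_(j in [set: 'I_m.+1]) (Omega_at j `&` eta j @^-1` O)); last first.
    apply/seteqP; split => w /=; first by move=> Ow; exists ((w : cadlag R m) 0).
    by move=> [j _ [/= wj]]; rewrite /select_curve /Omega_at /= in wj *; rewrite wj.
  apply: countable_bigcupT_measurable => [|j]; first exact: countableP.
  apply: measurableI; first exact: measurable_Omega_at.
  by have [[_ mj] _ _] := eta_adm j; exact: mj.
- move=> I itvI bI I0 e e0.
  have dj j : exists d : R, 0 < d /\ forall (n : nat) (a b : 'I_n -> R) (w : Omega R m),
      (forall k, a k < b k) -> (forall k, `]a k, b k[ `<=` I) ->
      trivIset setT (fun k => `]a k, b k[%classic) ->
      \sum_(k < n) (b k - a k) < d ->
      \sum_(k < n) enorm (eta j w (b k) - eta j w (a k)) < e.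
    by have [_ /(_ I itvI bI I0 e e0)[d d0 hd] _] := eta_adm j; exists d.
  have [d hd] := choice dj.
  exists (\big[Num.min/1]_j d j); first by apply: lt_bigmin => // j _; have [] := hd j.
  move=> n a b w ab abI tab sd; have [_] := hd ((w : cadlag R m) 0); apply => //.
  by apply: lt_le_trans sd _; apply: bigmin_le_cond.
(* Agreement on [[0, t]] includes time 0: both paths start in the same state and select the same
   curve. *)
- move=> t w1 w2 t0 w12 s st; rewrite /select_curve w12 ?lexx//.
  by have [_ _ /(_ t w1 w2 t0 w12 s st)] := eta_adm ((w2 : cadlag R m) 0).
Qed.

Lemma admissible_cst (x : 'rV[R]_N.+1) : admissible (fun (_ : Omega R m) (_ : R) => x).
Proof.
split.
- split=> [w|O oO]; first exact: cst_continuous.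
  by rewrite preimage_cst; case: ifP.
- move=> I _ _ _ e e0; exists 1 => // n a b w _ _ _ _.
  by rewrite big1// => k _; rewrite subrr enorm0.
- by [].
Qed.

End select.

Section concat.
Context {R : realType} {N m : nat}.
Variables (h : R) (h_ge0 : 0 <= h) (q : 'rV[R]_N.+1).
Variable eta : Omega R m -> R -> 'rV[R]_N.+1.
Local Notation theta := (shift_path h_ge0).

(* The line [s |-> eta 0 + (h - s) q] up to time [h], then [eta] restarted at
   time [h]; the formula with [Num.max] avoids a case distinction. *)
Definition concat_curve (w : Omega R m) (s : R) :=
  eta (theta w) (Num.max (s - h) 0) + Num.max (h - s) 0 *: q.

Hypothesis eta_adm : admissible eta.
Variable y : 'rV[R]_N.+1.
Hypothesis eta0 : forall w, eta w 0 = y.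

(** [concat_curve] is [restart] applied to [eta] at the shifted path; continuity of this operation
    on path space is what transfers measurability. *)
Let restart (c : {family compact_Rplus, R -> 'rV[R]_N.+1}) :
    {family compact_Rplus, R -> 'rV[R]_N.+1} :=
  fun s => c (Num.max (s - h) 0) + Num.max (h - s) 0 *: q.

Let restart_continuous : continuous restart.
Proof.
move=> c.
suff uc A : compact_Rplus A -> {uniform A, restart @ nbhs c --> restart c}.
  have FF : Filter (restart @ nbhs c) by apply: fmap_filter.
  exact: (fam_cvgP compact_Rplus (restart c) FF).2 uc.
move=> [cA A0].
move=> Q; rewrite uniform_nbhs => -[E [+ EQ]].
rewrite -entourage_ballE => -[e /= e0 eE].
(* Uniform closeness after restarting on [A] amounts to uniform closeness before it on the image of
   [A] under [g], again a compact set of nonnegative times. *)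
pose g (s : R) : R := Num.max (s - h) 0.
have gc : continuous g.
  move=> s; apply: (@continuous_comp _ _ _ (fun s => s - h) (fun s => Num.max s 0)).
    by apply: (@continuousB R R^o _ id (cst h)); [move=> ?|exact: cst_continuous].
  by apply: (@continuous_max0 _ _ id); apply: continuous_subspaceT => ?.
have gA : compact_Rplus (g @` A).
  split; first by apply: continuous_compact => //; exact: continuous_subspaceT.
  by move=> _ [s _ <-]; rewrite /= in_itv /= /g le_max lexx orbT.
have := (fam_cvgP compact_Rplus c (nbhs_filter c)).1 cvg_id _ gA.
move=> /(_ [set c' | forall r, (g @` A) r -> ball (c r) e (c' r)]) hc.
have {hc} : nbhs c [set c' | forall r, (g @` A) r -> ball (c r) e (c' r)].
  apply: hc; apply/uniform_nbhs; exists [set xy | ball xy.1 e xy.2]; split => //.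
  by rewrite -entourage_ballE; exists e.
move=> hcc; apply: (@filterS _ (nbhs c) (nbhs_filter c) _ _ _ hcc) => c' hc'.
apply: EQ => s sA; apply: eE => /=.
have : ball (c (g s)) e (c' (g s)) by apply: hc'; exists s.
rewrite mx_norm_ball /ball_ /restart /g /=.
by rewrite opprD addrACA subrr addr0.
Qed.

Let concat_random : random_curve concat_curve.
Proof.
have [[ce me] _ _] := eta_adm; split => [w|O oO].
  apply: continuous_subspaceT => s.
  apply: (@continuousD R 'rV[R]_N.+1 R (fun s => eta (theta w) (Num.max (s - h) 0)) (fun s => Num.max (h - s) 0 *: q)).
    apply: (@continuous_comp _ _ _ (fun s => s - h) (fun s => eta (theta w) (Num.max s 0))).
      by apply: (@continuousB R R^o _ id (cst h)); [move=> ?|exact: cst_continuous].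
    exact: continuous_max0.
  apply: (@continuousZr_tmp R 'rV[R]_N.+1 R (fun s => Num.max (h - s) 0)).
  apply: (@continuous_comp _ _ _ (fun s => h - s) (fun s => Num.max s 0)).
    by apply: (@continuousB R R^o _ (cst h) id); [exact: cst_continuous|move=> ?].
  by apply: (@continuous_max0 _ _ id); apply: continuous_subspaceT => ?.
have mt := measurable_shift_path h_ge0.
rewrite (_ : _ @^-1` _ = theta @^-1` (eta @^-1` (restart @^-1` O))); last first.
  by apply/seteqP; split.
rewrite -[X in measurable X]setTI; apply: mt => //; apply: me.
by apply: open_comp => // c _; exact: restart_continuous.
Qed.

(** The clock [max (s - h, 0)] is nondecreasing and 1-Lipschitz, so it maps disjoint intervals to
    disjoint intervals or points of no larger total length, on which [eta] varies by less than
    [e / 2]. The segment is Lipschitz with constant [|q|] and takes the other half. *)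
Let concat_equi_abs_continuous : equi_abs_continuous concat_curve.
Proof.
move=> I itvI [M [_ bM]] I0 e e0.
pose T : R := `|M| + 1.
have IM x : I x -> x <= T.
  move=> Ix; have := bM (`|M| + 1) _ x Ix; rewrite (le_lt_trans (ler_norm M)) ?ltrDl// => /(_ isT).
  by apply: le_trans; exact: ler_norm.
have [_ eta_ac _] := eta_adm.
have [||||d d0 hd] := eta_ac `[0, T]%classic _ _ _ (e / 2) _.
- exact: interval_is_interval.
- exists T; split; first exact: num_real.
  move=> x Tx z /=; rewrite in_itv /= => /andP[z0 zT].
  by rewrite ger0_norm// (le_trans zT)// ltW.
- by move=> z /=; rewrite !in_itv /= => /andP[->].
- by rewrite divr_gt0.
have c0 : 0 < 2 * (enorm q + 1) by rewrite mulr_gt0// ltr_wpDl// enorm_ge0.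
exists (Num.min d (e / (2 * (enorm q + 1)))); first by rewrite lt_min d0 divr_gt0.
move=> n a b w ab abI tab; rewrite lt_min => /andP[sd se].
pose g (s : R) := Num.max (s - h) 0.
have g_mono s r : s <= r -> 0 <= g r - g s <= r - s.
  by move=> sr; rewrite (_ : r - s = (r - h) - (s - h)) ?max0_sub ?lerD2r//; ring.
have g_dual s r : s <= r -> `|Num.max (h - r) 0 - Num.max (h - s) 0| <= r - s.
  move=> sr; apply: le_trans (max0_lipschitz _ _) _.
  by rewrite (_ : h - r - (h - s) = - (r - s)) ?normrN ?ger0_norm ?subr_ge0//; ring.
have g_ge s : s - h <= g s by rewrite /g le_max lexx.
have lt_le_g s r z : 0 <= g s -> g s < z -> z < g r -> z < r - h.
  by move=> gs gz; rewrite {1}/g lt_max => /orP[//|/(lt_trans gz)]; rewrite ltNge gs.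
have I_ge k : 0 <= a k.
  rewrite leNgt; apply/negP => ak0.
  have : I (a k / 2 + Num.min (b k) 0 / 2).
    by apply: (abI k); rewrite /= in_itv /=; have := ab k; case: (leP (b k) 0) => b0 akb; apply/andP; split; lra.
  by move=> /I0; rewrite /= in_itv /= andbT; case: (leP (b k) 0) => b0; lra.
(* Intervals that [g] collapses to a point contribute nothing and are discarded, as absolute
   continuity is stated for [a k < b k]. For the others, adding [h] sends the image back into the
   original interval, which gives disjointness and the bound by [T]. *)
pose Q := finset (fun k : 'I_n => g (a k) < g (b k)).
have S1 : \sum_(k < n) enorm (eta (theta w) (g (b k)) - eta (theta w) (g (a k))) < e / 2.
  rewrite (bigID (mem Q))/= [X in _ + X]big1 ?addr0; last first.
    move=> k; rewrite inE -leNgt => ba.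
    have /andP[+ _] := g_mono _ _ (ltW (ab k)); rewrite subr_ge0 => ab'.
    by have -> : g (b k) = g (a k) by [apply/eqP; rewrite eq_le ba]; rewrite subrr enorm0.
  rewrite big_enum_val/=.
  apply: (hd _ (fun k => g (a (enum_val k))) (fun k => g (b (enum_val k))) (theta w)).
  - by move=> k; have := enum_valP k; rewrite inE.
  - move=> k z /=; rewrite !in_itv /= => /andP[az zb].
    have gz : 0 <= g (a (enum_val k)) by rewrite /g le_max lexx orbT.
    rewrite (ltW (le_lt_trans gz az)) /=.
    have Iz : I (z + h).
      apply: (abI (enum_val k)); rewrite /= in_itv /=.
      by apply/andP; split; [rewrite -ltrBlDr (le_lt_trans (g_ge _) az)|rewrite -ltrBrDr (lt_le_g _ _ _ gz az zb)].
    by apply: le_trans (IM _ Iz); rewrite lerDl.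
  - apply/trivIsetP => k l _ _ kl; apply/seteqP; split => // z [/=].
    rewrite !in_itv /= => /andP[az zb] /andP[az' zb'].
    move/trivIsetP : tab => /(_ (enum_val k) (enum_val l) Logic.I Logic.I).
    rewrite (inj_eq enum_val_inj) => /(_ kl) /seteqP[+ _] => /(_ (z + h)); apply.
    have g0 : 0 <= g (a (enum_val k)) by rewrite /g le_max lexx orbT.
    have g0' : 0 <= g (a (enum_val l)) by rewrite /g le_max lexx orbT.
    split; rewrite /= in_itv /=; apply/andP; split.
    + by rewrite -ltrBlDr (le_lt_trans (g_ge _) az).
    + by rewrite -ltrBrDr (lt_le_g _ _ _ g0 az zb).
    + by rewrite -ltrBlDr (le_lt_trans (g_ge _) az').
    + by rewrite -ltrBrDr (lt_le_g _ _ _ g0' az' zb').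
  - apply: le_lt_trans sd.
    have <- : \sum_(k in Q) (g (b k) - g (a k)) =
        \sum_(k < #|Q|) (g (b (enum_val k)) - g (a (enum_val k))) by rewrite big_enum_val.
    rewrite [leRHS](bigID (mem Q))/= ler_wpDr//.
      by apply: sumr_ge0 => k _; rewrite subr_ge0 ltW.
    by apply: ler_sum => k _; have /andP[] := g_mono _ _ (ltW (ab k)).
have S2 : \sum_(k < n) enorm ((Num.max (h - b k) 0 - Num.max (h - a k) 0) *: q) <= e / 2.
  apply: (@le_trans _ _ (\sum_(k < n) (b k - a k) * (enorm q + 1))).
    apply: ler_sum => k _; rewrite enormZ ler_pM ?enorm_ge0//.
      exact: g_dual (ltW (ab k)).
    by rewrite lerDl.
  rewrite -mulr_suml; move: se; rewrite invfM mulrA ltr_pdivlMr; first exact: ltW.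
  by rewrite ltr_wpDl// enorm_ge0.
rewrite [ltRHS]splitr; apply: le_lt_trans (ltr_leD S1 S2).
rewrite -big_split; apply: ler_sum => k _ /=.
apply: le_trans (enorm_triangle _ _).
by rewrite /concat_curve opprD addrACA -scalerBl.
Qed.

(** Up to time [h] the curve depends on [eta] only through its starting point, which is [y] for
    every path; at a later time [s] it sees the shifted path on [[0, s - h]], that is the original
    one on [[h, s]]. *)
Let concat_nonanticipating : nonanticipating concat_curve.
Proof.
have [_ _ na] := eta_adm.
move=> t w1 w2 t0 w12 s /andP[s0 st]; rewrite /concat_curve; congr (_ + _).
have [sh|hs] := leP s h; first by rewrite max_r ?subr_le0// !eta0.
have hs' : 0 <= s - h by rewrite subr_ge0 ltW.
rewrite max_l//; apply: (na (s - h)) => //; last by rewrite hs' lexx.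
move=> r /andP[r0 rs]; rewrite !shift_pathE//; apply: w12.
by rewrite addr_ge0//=; lra.
Qed.

Lemma admissible_concat : admissible concat_curve.
Proof. by split. Qed.

Lemma concat_curve_start w : concat_curve w 0 = y + h *: q.
Proof. by rewrite /concat_curve sub0r subr0 max_r ?oppr_le0// max_l// eta0. Qed.

Lemma concat_curve_line w s : s <= h -> concat_curve w s = y + (h - s) *: q.
Proof.
by move=> sh; rewrite /concat_curve max_r ?subr_le0// max_l ?subr_ge0// eta0.
Qed.

Lemma concat_curve_restart w s : h <= s -> concat_curve w s = eta (theta w) (s - h).
Proof.
move=> hs; rewrite /concat_curve max_l ?subr_ge0// (max_r (x := h - s)) ?subr_le0//.
by rewrite scale0r addr0.
Qed.

Lemma derive1_concat_line w s : s < h -> derive1 (concat_curve w) s = - q.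
Proof.
move=> sh; rewrite /derive1; apply: cvg_lim => //.
apply: cvg_near_cst; exists (h - s) => /=; first by rewrite subr_gt0.
move=> r /=; rewrite sub0r normrN ltr_norml => /andP[r1 r2] r0.
rewrite !concat_curve_line ?(ltW sh)//; last lra.
have zm (u v : 'rV[R]_N.+1) : y + u - (y + v) = u - v.
  by rewrite opprD addrACA subrr add0r.
rewrite zm -scalerBl scalerA.
rewrite (_ : _ * _ = - 1) ?scaleN1r//.
by rewrite (_ : _ - _ = - r) ?mulrN ?mulVf//; ring.
Qed.

Lemma derive1_concat_restart w s : h < s ->
  derive1 (concat_curve w) s = derive1 (eta (theta w)) (s - h).
Proof.
move=> hs; rewrite /derive1; congr (lim _); apply: near_fmap_eq.
exists (s - h) => /=; first by rewrite subr_gt0.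
move=> r /=; rewrite sub0r normrN ltr_norml => /andP[r1 r2] r0.
by rewrite !concat_curve_restart ?(ltW hs) ?addrA//; lra.
Qed.

End concat.

(** * Dynamic programming inequality *)

Section off_time.
Context {R : realType} {m : nat}.
Local Notation mu := (@lebesgue_measure R).

Definition off_time (h : R) (i : 'I_m.+1) (w : Omega R m) : \bar R :=
  (\int[mu]_(s in `]0%R, h]) (\1_[set s | (w : cadlag R m) s != i] s)%:E)%E.

Definition off_set (h : R) (i : 'I_m.+1) : set (Omega R m * R) :=
  [set z | (z.1 : cadlag R m) z.2 != i] `&` (setT `*` `]0, h]%classic).

Let measurable_off (i : 'I_m.+1) :
  measurable [set z : Omega R m * R | (z.1 : cadlag R m) z.2 != i].
Proof.
rewrite (_ : mkset _ = ~` [set z | (z.1 : cadlag R m) z.2 = i]).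
  by apply: measurableC; exact: measurable_state.
by apply/seteqP; split => z /= /eqP.
Qed.

Lemma measurable_off_times (i : 'I_m.+1) (w : cadlag R m) : measurable [set s | w s != i].
Proof.
have mw : measurable_fun setT (fun s : R => (w : Omega R m, s)) by exact: measurable_pair1.
by rewrite -[X in measurable X]setTI; exact: (mw measurableT _ (measurable_off i)).
Qed.

Lemma measurable_off_set h i : measurable (off_set h i).
Proof.
by apply: measurableI => //; apply: measurableX => //; exact: measurable_itv.
Qed.

Lemma off_timeE h i w : off_time h i w = (\int[mu]_s (\1_(off_set h i) (w, s))%:E)%E.
Proof.
rewrite /off_time integral_mkcond; apply: eq_integral => s _.
rewrite patchE !indicE; case: ifPn => [/set_mem sh|/negP sh].
  congr ((nat_of_bool _)%:R)%:E; apply/idP/idP => /set_mem /=; last by case=> ? _; exact/mem_set.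
  by move=> wi; apply/mem_set.
by rewrite memNset//= => -[_ [_]] /mem_set.
Qed.

Lemma off_time_ge0 h i w : (0 <= off_time h i w)%E.
Proof. by apply: integral_ge0 => s _; rewrite lee_fin indicE ler0n. Qed.

Lemma measurable_off_time h i : measurable_fun setT (off_time h i).
Proof.
rewrite (_ : off_time h i = fubini_F mu (fun z => (\1_(off_set h i) z)%:E)).
  apply: measurable_fun_fubini_tonelli_F => [|z]; last by rewrite lee_fin indicE ler0n.
  by apply/measurable_EFinP; apply: measurable_indic; exact: measurable_off_set.
by apply/funext => w; exact: off_timeE.
Qed.

End off_time.

Section concat_action.
Context {R : realType} {N m : nat}.
Variables (H : 'I_m.+1 -> 'rV[R]_N.+1 -> 'rV[R]_N.+1 -> R).
Hypothesis H_unif : forall i, unif_cont_on_balls (H i).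
Variables (K : R).
Hypothesis K_ge0 : 0 <= K.
Hypothesis L_lower : forall i x q, ((- K)%:E <= lagrangian H i x q)%E.
Variables (u0 : 'rV[R]_N.+1 -> 'cV[R]_m.+1).
Variables (h : R) (h_ge0 : 0 <= h) (q : 'rV[R]_N.+1).
Variable eta : Omega R m -> R -> 'rV[R]_N.+1.
Hypothesis eta_adm : admissible eta.
Variable y : 'rV[R]_N.+1.
Hypothesis eta0 : forall w, eta w 0 = y.
Local Notation mu := (@lebesgue_measure R).
Local Notation theta := (shift_path h_ge0).
Local Notation gamma := (concat_curve h_ge0 q eta).

Variables (i : 'I_m.+1) (l C : R).
Hypothesis C_ge0 : 0 <= C.
Hypothesis L_i : forall s, 0 <= s <= h -> (lagrangian H i (y + s *: q) q <= l%:E)%E.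
Hypothesis L_j : forall j x, (lagrangian H j x q <= (l + C)%:E)%E.

(** Before time [h] the velocity is [-q]: the Lagrangian is at most [l] in state [i] and [l + C]
    elsewhere, which produces the off-time. After [h], translation gives back the action of [eta] on
    the shifted path. The terms in [K] make the integrands nonnegative, so that the integral can be
    split. *)
Lemma action_concat_le (t : R) w : h <= t ->
  (action H u0 t gamma w + (K * t)%:E <=
   (h * (l + K))%:E + C%:E * off_time h i w +
   (action H u0 (t - h) eta (theta w) + (K * (t - h))%:E))%E.
Proof.
move=> ht.
have t0 : 0 <= t := le_trans h_ge0 ht.
have th0 : 0 <= t - h by rewrite subr_ge0.
have gamma_adm := admissible_concat h_ge0 q eta_adm eta0.
have [gamma_rand _ _] := gamma_adm; have [eta_rand _ _] := eta_adm.
have L0 g (w' : Omega R m) s : (0 <= lagrangian_along H g w' s + K%:E)%E.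
  by have := leeD2r K%:E (L_lower _ _ _); rewrite -EFinD addNr; apply.
have mL g (w' : Omega R m) (t' : R) : random_curve g ->
    measurable_fun `]0, t'] (fun s => lagrangian_along H g w' s + K%:E)%E.
  move=> gr; have m1 := measurable_lagrangian_path H_unif K gr w' (t := t').
  exact: (emeasurable_funD m1 (measurable_cst K%:E)).
rewrite [leLHS](action_shift H_unif K_ge0 L_lower gamma_rand u0 w t0).
rewrite [X in (_ <= _ + X)%E](action_shift H_unif K_ge0 L_lower eta_rand u0 (theta w) th0).
rewrite concat_curve_restart// (_ : (theta w : cadlag R m) (t - h) = (w : cadlag R m) t); last first.
  by rewrite shift_pathE// addrC subrK.
rewrite [leRHS]addeCA; apply: leeD2l.
have U : `]0, t]%classic = `]0, h]%classic `|` `]h, t]%classic.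
  by rewrite -itv_bndbnd_setU// ?bnd_simp.
rewrite U ge0_integral_setU//=; last 2 first.
- by rewrite -U; exact: mL.
- apply/disj_setPRL => s /=; rewrite !in_itv /= => /andP[hs _] /andP[_ sh].
  by move: hs; rewrite ltNge sh.
apply: leeD; last first.
  rewrite [leRHS](@ge0_integral_translation _ h); last 2 first.
  - exact: mL.
  - by move=> s _; exact: L0.
  rewrite add0r subrK le_eqVlt; apply/orP; left; apply/eqP.
  apply: eq_integral => s /[!inE] /=; rewrite in_itv /= => /andP[hs _].
  rewrite /lagrangian_along derive1_concat_restart// concat_curve_restart ?(ltW hs)//.
  by rewrite shift_pathE ?subr_ge0 ?(ltW hs)// (addrC h) subrK.
have lK0 : 0 <= l + K.
  have := le_trans (L_lower i (y + 0 *: q) q) (L_i _); rewrite lexx h_ge0 => /(_ isT).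
  by rewrite lee_fin -subr_ge0 opprK.
have mh : measurable (`]0, h]%classic : set R) by exact: measurable_itv.
pose f (s : R) := ((l + K)%:E + C%:E * (\1_[set s | w s != i] s)%:E)%E.
have m1 : measurable_fun setT (fun s : R => (\1_[set s | w s != i] s)%:E : \bar R).
  by apply/measurable_EFinP; apply: measurable_indic; exact: measurable_off_times.
have m2 : measurable_fun setT (fun s : R => C%:E * (\1_[set s | w s != i] s)%:E)%E.
  exact: measurable_funeM.
have mf : measurable_fun setT f by exact: (emeasurable_funD (measurable_cst (l + K)%:E) m2).
have C1 s : (0 <= C%:E * (\1_[set s | w s != i] s)%:E)%E.
  by rewrite mule_ge0 ?lee_fin// indicE ler0n.
have -> : ((h * (l + K))%:E + C%:E * off_time h i w = \int[mu]_(s in `]0%R, h]) f s)%E.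
  rewrite ge0_integralD//; last exact: measurable_funTS.
  rewrite integral_cst//= ge0_integralZl//; last exact: measurable_funTS.
  by rewrite [X in (_ = _ * X + _)%E](lebesgue_measure_0t h_ge0) -EFinM mulrC.
have mo : measurable_fun `]0, h[ (fun s => lagrangian_along H gamma w s + K%:E)%E.
  by apply: measurable_funS (mL _ w h gamma_rand) => //; apply: subset_itv; rewrite bnd_simp.
(* The curve may have a kink at time [h], so this endpoint is dropped before the derivative is
   computed. *)
rewrite -[leLHS]integral_itv_bndo_bndc//.
rewrite -[leRHS]integral_itv_bndo_bndc; last exact: measurable_funTS.
apply: ge0_le_integral => //.
- exact: measurable_funTS.
- move=> s /=; rewrite in_itv /= => /andP[s0 sh].
  rewrite /lagrangian_along /f (derive1_concat_line _ _ eta0)// opprK (concat_curve_line _ _ eta0) ?(ltW sh)//.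
  rewrite indicE; have [wi|wi] := eqVneq (w s) i.
    rewrite memNset /= ?wi ?eqxx// mule0 adde0 EFinD leeD2r//.
    by apply: L_i; rewrite subr_ge0 (ltW sh)/= gerBl ltW.
  rewrite mem_set// mule1 -EFinD addrAC EFinD leeD2r//.
Qed.

End concat_action.

Lemma integral_le_cstDD d (T : measurableType d) (R : realType)
    (p : probability T R) (a : R) (f g k : T -> \bar R) : 0 <= a ->
  measurable_fun setT f -> measurable_fun setT g -> measurable_fun setT k ->
  (forall x, 0 <= f x)%E -> (forall x, 0 <= g x)%E -> (forall x, 0 <= k x)%E ->
  (forall x, f x <= a%:E + g x + k x)%E ->
  (\int[p]_x f x <= a%:E + \int[p]_x g x + \int[p]_x k x)%E.
Proof.
move=> a0 mf mg mk f0 g0 k0 fgk.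
have -> : a%:E = (\int[p]_x a%:E)%E.
  by rewrite integral_cst// [X in (_ = _ * X)%E]probability_setT mule1.
have mag : measurable_fun setT (fun x => a%:E + g x)%E by exact: (emeasurable_funD (measurable_cst _) mg).
rewrite -ge0_integralD// -ge0_integralD//; last by move=> x _; rewrite adde_ge0.
apply: ge0_le_integral => //; last exact: (emeasurable_funD mag mk).
Qed.

Section value_function.
Context {R : realType} {N m : nat}.
Variables (H : 'I_m.+1 -> 'rV[R]_N.+1 -> 'rV[R]_N.+1 -> R).
Hypothesis H_unif : forall i, unif_cont_on_balls (H i).
Variables (K C0 : R).
Hypothesis K_ge0 : 0 <= K.
Hypothesis L_lower : forall i x q, ((- K)%:E <= lagrangian H i x q)%E.
Hypothesis C0_ge0 : 0 <= C0.
Hypothesis L_upper0 : forall i x, (lagrangian H i x 0 <= C0%:E)%E.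
Variables (B : 'M[R]_m.+1) (P : probability (Omega R m) R).
Hypothesis P_markov : markov_chain B P.
Hypothesis P_start : forall i : 'I_m.+1, (0 < P (Omega_at i))%E.
Variables (u0 : 'rV[R]_N.+1 -> 'cV[R]_m.+1) (M : R).
Hypothesis u0_cont : continuous u0.
Hypothesis M_ge0 : 0 <= M.
Hypothesis u0_bound : forall x i, `|u0 x i 0| <= M.
Local Notation trans h := (expmx ((- h) *: B)).
Local Notation v t x i := (lax_oleinik H P t u0 x i 0).
Local Notation cost t i gamma := (\int[cond_prob P i]_w action H u0 t gamma w)%E.
Local Notation mu := (@lebesgue_measure R).

Let shift_ge0 (t : R) : 0 <= t -> 0 <= M + K * t.
Proof. by move=> t0; rewrite addr_ge0// mulr_ge0. Qed.

Lemma cost_shift (t : R) i gamma : 0 <= t -> random_curve gamma ->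
  (\int[cond_prob P i]_w (action H u0 t gamma w + (M + K * t)%:E) =
   cost t i gamma + (M + K * t)%:E)%E.
Proof.
move=> t0 gr; rewrite integral_lower_bounded_shift//.
- by rewrite [X in (_ + _ * X)%E]probability_setT mule1.
- by rewrite [X in (X < _)%E]probability_setT ltry.
- exact: (measurable_action H_unif K_ge0 L_lower gr u0_cont t0).
- exact: shift_ge0.
- by move=> w _; exact: (action_ge H_unif K_ge0 L_lower gr u0_bound w t0).
Qed.

Lemma cost_ge (t : R) i gamma : 0 <= t -> random_curve gamma ->
  ((- (M + K * t))%:E <= cost t i gamma)%E.
Proof.
move=> t0 gr; have := cost_shift i t0 gr.
have : (0 <= \int[cond_prob P i]_w (action H u0 t gamma w + (M + K * t)%:E))%E.
  apply: integral_ge0 => w _.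
  by have := leeD2r (M + K * t)%:E (action_ge H_unif K_ge0 L_lower gr u0_bound w t0); rewrite -EFinD addNr.
by move=> /[swap] -> h0; rewrite EFinN -sub0e leeBlDr.
Qed.

Lemma cost_cst_le (t : R) i x : 0 <= t ->
  (cost t i (fun _ _ => x) <= (M + C0 * t)%:E)%E.
Proof.
move=> t0; have [gr _ _] := admissible_cst (m := m) x.
rewrite -(@leeD2rE _ (M + K * t)%:E)// -cost_shift//.
have -> : ((M + C0 * t)%:E + (M + K * t)%:E =
    \int[cond_prob P i]_w ((M + C0 * t) + (M + K * t))%:E)%E.
  by rewrite integral_cst// [X in (_ = _ * X)%E]probability_setT mule1.
have ma := measurable_action H_unif K_ge0 L_lower gr u0_cont t0.
apply: ge0_le_integral => //.
- move=> w _.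
  by have := leeD2r (M + K * t)%:E (action_ge H_unif K_ge0 L_lower gr u0_bound w t0); rewrite -EFinD addNr.
- exact: (emeasurable_funD ma (measurable_cst _)).
- move=> w _; rewrite [leRHS]EFinD leeD2r//.
  rewrite -(@leeD2rE _ (K * t)%:E)// [leLHS](action_shift H_unif K_ge0 L_lower gr u0 w t0).
  rewrite -EFinD -addrA EFinD; apply: leeD.
    by rewrite lee_fin; exact: le_trans (ler_norm _) (u0_bound _ _).
  have -> : (C0 * t + K * t)%:E = (\int[mu]_(s in `]0%R, t]) (C0 + K)%:E)%E.
    rewrite integral_cst// [X in (_ = _ * X)%E](lebesgue_measure_0t t0) -EFinM.
    by rewrite mulrDl.
  apply: ge0_le_integral => //.
  + by move=> s _; have := leeD2r K%:E (L_lower _ _ _); rewrite -EFinD addNr; apply.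
  + have m1 := measurable_lagrangian_path H_unif K gr w (t := t).
    exact: (emeasurable_funD m1 (measurable_cst K%:E)).
  + move=> s _; rewrite EFinD leeD2r// /lagrangian_along.
    by rewrite derive1_cst oppr0.
Qed.

(** The infimum lies between [- (M + K * t)] and [M + C0 * t], the latter by testing the constant
    curve, so [fine] discards nothing. *)
Lemma lax_oleinikE (t : R) x i : 0 <= t ->
  (v t x i)%:E = ereal_inf [set cost t i gamma | gamma in
      [set gamma | admissible gamma /\ forall w, gamma w 0%R = x]].
Proof.
move=> t0; rewrite /lax_oleinik mxE fineK//.
rewrite fin_numElt; apply/andP; split.
  apply: (@lt_le_trans _ _ (- (M + K * t))%:E); first exact: ltNyr.
  by apply: le_ereal_inf_tmp => _ [gamma [[gr _ _] _] <-]; exact: cost_ge.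
apply: le_lt_trans (ltry (M + C0 * t)); apply: le_trans (cost_cst_le i x t0).
by apply: ereal_inf_lbound; exists (fun _ _ => x) => //; split => //; exact: admissible_cst.
Qed.

Lemma lax_oleinik_le (t : R) x i gamma : 0 <= t -> admissible gamma ->
  (forall w, gamma w 0 = x) -> ((v t x i)%:E <= cost t i gamma)%E.
Proof.
by move=> t0 ga gx; rewrite lax_oleinikE//; apply: ereal_inf_lbound; exists gamma.
Qed.

Lemma lax_oleinik_adherent (t : R) x i e : 0 <= t -> 0 < e -> exists gamma,
  [/\ admissible gamma, forall w, gamma w 0 = x & (cost t i gamma <= (v t x i + e)%:E)%E].
Proof.
move=> t0 e0; have := @lb_ereal_inf_adherent _ ([set cost t i gamma | gamma in
      [set gamma | admissible gamma /\ forall w, gamma w 0%R = x]]) _ e0.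
rewrite -lax_oleinikE// => /(_ isT)[_ [gamma [ga gx] <-] /ltW].
by exists gamma; split.
Qed.

Lemma lax_oleinik_le_bound (t : R) x i : 0 <= t -> v t x i <= M + C0 * t.
Proof.
move=> t0; rewrite -lee_fin; apply: le_trans (cost_cst_le i x t0).
by apply: lax_oleinik_le => //; exact: admissible_cst.
Qed.

Lemma lax_oleinik0_le x i : v 0 x i <= u0 x i 0.
Proof.
have adm := admissible_cst (m := m) x; have [gr _ _] := adm.
rewrite -lee_fin; apply: le_trans (lax_oleinik_le i (lexx 0) adm (fun=> erefl)) _.
rewrite (integral_cond_prob_eq P_start (G := cst (u0 x i 0)%:E))//.
- by rewrite integral_cst// [X in (_ * X)%E]probability_setT mule1.
- exact: (measurable_action H_unif K_ge0 L_lower gr u0_cont (lexx 0)).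
- by move=> w wi; rewrite /action set_itv1 integral_set1 adde0 wi.
Qed.

(** By Tonelli the expectation is the integral over []0, h]] of [1 - trans s i i], at most
    [s B_ii + c s^2] by the first-order expansion, hence at most [(c + S) h]. The sum [S] of all
    [|B j j|] makes the constant independent of [i]. *)
Lemma expected_off_time_le : exists2 c : R, 0 <= c & forall (h : R) i, 0 <= h <= 1 ->
  (\int[cond_prob P i]_w off_time h i w <= (c * h ^+ 2)%:E)%E.
Proof.
have [c c0 hc] := expmx_first_order B.
pose S : R := \sum_j `|B j j|; have S0 : 0 <= S by exact: sumr_ge0.
exists (c + S); first by rewrite addr_ge0.
move=> h i /andP[h0 h1].
pose F (z : Omega R m * R) : \bar R := (\1_(off_set h i) z)%:E.
have mF : measurable_fun setT F.
  by apply/measurable_EFinP; apply: measurable_indic; exact: measurable_off_set.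
have F0 z : (0 <= F z)%E by rewrite lee_fin indicE ler0n.
under eq_integral do rewrite off_timeE.
rewrite (@fubini_tonelli _ _ _ _ _ (cond_prob P i) mu F)//.
have c'0 : 0 <= c + S by rewrite addr_ge0.
apply: (@le_trans _ _ (\int[mu]_(s in `]0%R, h]) ((c + S) * h)%:E)%E); last first.
  rewrite integral_cst// [X in (_ * X <= _)%E](lebesgue_measure_0t h0) -EFinM.
  by rewrite -mulrA.
rewrite [leRHS]integral_mkcond; apply: ge0_le_integral => //.
- by move=> s _; apply: integral_ge0 => w _.
- exact: measurable_fun_fubini_tonelli_G.
- by apply: (iffLR (measurable_restrictT _ _)); [exact: measurable_itv|exact: measurable_cst].
move=> s _; rewrite patchE; case: ifPn => [/set_mem|/negP] sh; last first.
  rewrite integral0_eq// => w _; rewrite /F indicE memNset//= => -[_ [_]] /= hs.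
  by apply: sh; apply/mem_set.
have [s0 s1] : 0 < s /\ s <= h by move: sh; rewrite /= in_itv => /andP[].
have -> : (\int[cond_prob P i]_w F (w, s) = \int[cond_prob P i]_w (\1_(~` [set w : cadlag R m | w s = i]) w)%:E)%E.
  apply: eq_integral => w _; rewrite /F !indicE; congr ((nat_of_bool _)%:R)%:E.
  apply/idP/idP => /set_mem /=; first by move=> [/= /eqP wi _]; apply/mem_set.
  by move=> /= wi; apply/mem_set; split => //=; apply/eqP.
rewrite integral_indic//; last exact: measurableC (measurable_eval _ _).
rewrite setIT [leLHS]probability_setC; last exact: measurable_eval.
rewrite [X in (_ - X <= _)%E](cond_prob_eval P_markov P_start)// -EFinB lee_fin.
have sb : 0 <= s <= 1 by rewrite (ltW s0) (le_trans s1).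
have := hc s i i sb; rewrite eqxx mulr1n ler_norml => /andP[+ _] => hs.
have Bi : B i i <= S.
  by rewrite /S (bigD1 i)//= (le_trans (ler_norm _))// lerDl sumr_ge0.
have : s * B i i <= h * S.
  apply: (@le_trans _ _ (s * S)); first by rewrite ler_wpM2l// ltW.
  by rewrite ler_wpM2r.
have : c * s ^+ 2 <= c * h.
  by rewrite ler_wpM2l// expr2 -[leRHS]mulr1 ler_pM ?(ltW s0)//; case/andP: sb.
by move: hs; rewrite mulrDl => ? ? ?; lra.
Qed.

(* The paths that leave the state [i] before time [h] cost at most [C] more per
   unit of time spent off [i], whose expectation is [O(h^2)]. *)
Lemma dynamic_programming_le (c h t C l : R) (i : 'I_m.+1) (x q : 'rV[R]_N.+1) :
  0 < h -> h <= t ->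
  (\int[cond_prob P i]_w off_time h i w <= (c * h ^+ 2)%:E)%E -> 0 <= C ->
  (forall s, 0 <= s <= h -> (lagrangian H i (x - s *: q) q <= l%:E)%E) ->
  (forall j x, (lagrangian H j x q <= (l + C)%:E)%E) ->
  v t x i <= \sum_j trans h i j * v (t - h) (x - h *: q) j + h * l + C * c * h ^+ 2.
Proof.
move=> h0 ht ch C_ge0 L_i L_j.
pose h_ge0 : 0 <= h := ltW h0; have t0 : 0 <= t := le_trans h_ge0 ht.
have th0 : 0 <= t - h by rewrite subr_ge0.
apply/ler_addgt0Pr => e e0.
set y := x - h *: q.
have [eta eta_opt] := choice (fun j => lax_oleinik_adherent y j th0 e0).
have eta_adm : admissible (select_curve eta) by apply: admissible_select => j; have [] := eta_opt j.
have eta0 w : select_curve eta w 0 = y by rewrite /select_curve; have [_ ->] := eta_opt ((w : cadlag R m) 0).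
have gamma_adm := admissible_concat h_ge0 q eta_adm eta0.
set gamma := concat_curve _ _ _ in gamma_adm.
have gamma0 w : gamma w 0 = x by rewrite /gamma (concat_curve_start _ _ eta0) subrK.
have [gr _ _] := gamma_adm; have [er _ _] := eta_adm.
have c1 := lax_oleinik_le i t0 gamma_adm gamma0.

have A0 g s w : random_curve g -> 0 <= s -> (0 <= action H u0 s g w + (M + K * s)%:E)%E.
  move=> gr' s0; have := leeD2r (M + K * s)%:E (action_ge H_unif K_ge0 L_lower gr' u0_bound w s0).
  by rewrite -EFinD addNr.
have mA g s : random_curve g -> 0 <= s ->
    measurable_fun setT (fun w : Omega R m => action H u0 s g w + (M + K * s)%:E)%E.
  move=> gr' s0; have m1 := measurable_action H_unif K_ge0 L_lower gr' u0_cont s0.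
  exact: (emeasurable_funD m1 (measurable_cst _)).
have lK0 : 0 <= l + K.
  have := le_trans (L_lower i (x - 0 *: q) q) (L_i _ _); rewrite lexx h_ge0 => /(_ isT).
  by rewrite lee_fin -subr_ge0 opprK.
have mth : measurable_fun setT (@shift_path R m h h_ge0) := measurable_shift_path h_ge0.
have mAth := measurableT_comp (mA _ _ er th0) mth.
have mCoff : measurable_fun setT (fun w => C%:E * off_time h i w)%E.
  by apply: measurable_funeM; exact: measurable_off_time.
have Coff0 w : (0 <= C%:E * off_time h i w)%E by rewrite mule_ge0 ?lee_fin ?off_time_ge0.
have step : (\int[cond_prob P i]_w (action H u0 t gamma w + (M + K * t)%:E) <=
    (h * (l + K))%:E + C%:E * \int[cond_prob P i]_w off_time h i w +
    \sum_j (trans h i j)%:E * \int[cond_prob P j]_w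
      (action H u0 (t - h) (select_curve eta) w + (M + K * (t - h))%:E))%E.
  have L_y s : 0 <= s <= h -> (lagrangian H i (y + s *: q) q <= l%:E)%E.
    move=> /andP[s0 sh]; 
    have -> : y + s *: q = x - (h - s) *: q by rewrite /y scalerBl opprB [RHS]addrA [RHS]addrAC.
    apply: L_i.
    by rewrite subr_ge0 sh gerBl s0.
  rewrite -(integral_shift P_markov P_start h0 i (mA _ _ er th0))//; last first.
    by move=> w; exact: A0.
  rewrite -ge0_integralZl//; last 2 first.
  - exact: measurable_off_time.
  - by move=> w _; exact: off_time_ge0.
  apply: (integral_le_cstDD _ _ (mA _ _ gr t0) mCoff mAth).
  - by rewrite mulr_ge0.
  - by move=> w; exact: A0.
  - by [].
  - by move=> w; exact: A0.
  - move=> w.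
    have := action_concat_le H_unif K_ge0 L_lower u0 h_ge0 eta_adm eta0 C_ge0 L_y L_j w ht.
    have addM (a : \bar R) (k : R) : (a + (M + k)%:E = M%:E + (a + k%:E))%E by rewrite EFinD addeCA.
    move=> /(leeD2l M%:E).
    by rewrite -[in leLHS]addM [in leRHS]addeCA -[in leRHS]addM.
(* Under [cond_prob P j] the initial state is almost surely [j], so the selected curve costs as much
   as [eta j], nearly optimal from [y]. *)
have cost_j j : (\int[cond_prob P j]_w
      (action H u0 (t - h) (select_curve eta) w + (M + K * (t - h))%:E) <=
    (v (t - h) y j + e + (M + K * (t - h)))%:E)%E.
  have [[ejr ? ?] ej0 ej] := eta_opt j.
  rewrite (integral_cond_prob_eq P_start (mA _ _ er th0) (mA _ _ ejr th0)); last first.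
    by move=> w wj; rewrite /action /select_curve wj.
  by rewrite cost_shift// [leRHS]EFinD; exact: leeD2r.
move: step; rewrite cost_shift// => step.
rewrite -lee_fin -(@leeD2rE _ (M + K * t)%:E)//.
apply: le_trans (leeD2r _ c1) _; apply: le_trans step _.
apply: (@le_trans _ _ ((h * (l + K))%:E + C%:E * (c * h ^+ 2)%:E +
    \sum_j (trans h i j)%:E * (v (t - h) y j + e + (M + K * (t - h)))%:E)%E).
  apply: leeD; first by rewrite leeD2l// lee_wpmul2l ?lee_fin.
  apply: lee_sum => j _; apply: lee_wpmul2l => //.
  by rewrite lee_fin (trans_ge0 P_markov P_start).
under eq_bigr do rewrite -EFinM.
(* The rows of the transition matrix sum to 1, so [e] and the shift leave the sum, and the shifts
   balance: [h * K + (M + K * (t - h)) = M + K * t]. *)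
rewrite sumEFin -EFinM -!EFinD lee_fin.
under eq_bigr do rewrite -addrA mulrDr.
rewrite big_split/= -mulr_suml (trans_sum1 P_markov P_start)// mul1r.
by lra.
Qed.

End value_function.

(** * Viscosity inequality for the upper semicontinuous envelope *)

Section usc_envelope.
Context {R : realType} {N : nat}.
Local Notation spacetime := (R * 'rV[R]_N.+1)%type.
Implicit Types (f : spacetime -> R) (z : spacetime) (c : R).

Lemma usc_env_le f z c : (\forall y \near z, 0 <= y.1 -> f y <= c) ->
  (usc_env f z <= c%:E)%E.
Proof.
move=> fc; rewrite /usc_env limf_esupE; apply: ereal_inf_le.
exists (ereal_sup [set (f y)%:E | y in [set y | 0 <= y.1 /\ f y <= c]]).
  exists [set y | 0 <= y.1 /\ f y <= c] => //=.
  by rewrite /within /=; apply: filterS fc => y fy y0; split => //; exact: fy.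
by apply: ge_ereal_sup => _ [y [_ fy] <-]; rewrite lee_fin.
Qed.

Lemma le_usc_env f z : 0 <= z.1 -> ((f z)%:E <= usc_env f z)%E.
Proof.
move=> z0; rewrite /usc_env limf_esupE; apply: le_ereal_inf_tmp => _ [A /= FA <-].
apply: ereal_sup_ubound; exists z => //.
exact: (nbhs_singleton FA).
Qed.

Lemma usc_env_lt f z c : (usc_env f z < c%:E)%E ->
  \forall y \near z, 0 <= y.1 -> f y <= c.
Proof.
rewrite /usc_env limf_esupE => /ereal_inf_lt[_ [A /= FA <-] Ac].
have {}FA : nbhs z [set y | 0 <= y.1 -> A y] := FA.
apply: filterS FA => y Ay y0; rewrite -lee_fin; apply: le_trans (ltW Ac).
by apply: ereal_sup_ubound; exists y => //; exact: Ay.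
Qed.

Lemma usc_env_fin_num f z c : 0 <= z.1 ->
  (\forall y \near z, 0 <= y.1 -> f y <= c) -> usc_env f z \is a fin_num.
Proof.
move=> z0 /usc_env_le fc; rewrite fin_numElt.
by rewrite (lt_le_trans (ltNyr _) (le_usc_env f z0)) (le_lt_trans fc (ltry _)).
Qed.

End usc_envelope.
Section usc_envelope_vector.
Context {R : realType} {N m : nat}.
Local Notation spacetime := (R * 'rV[R]_N.+1)%type.
Variable w : spacetime -> 'cV[R]_m.+1.
Hypothesis w_bounded : forall (z : spacetime) j, 0 <= z.1 ->
  exists c, \forall y \near z, 0 <= y.1 -> w y j 0 <= c.

Lemma usc_envvE z j : 0 <= z.1 ->
  (usc_envv w z j 0)%:E = usc_env (fun y => w y j 0) z.
Proof.
move=> z0; rewrite /usc_envv mxE fineK//.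
by have [c wc] := w_bounded j z0; exact: usc_env_fin_num wc.
Qed.

Lemma usc_envv_le (z : spacetime) j c : 0 <= z.1 ->
  (\forall y \near z, 0 <= y.1 -> w y j 0 <= c) -> usc_envv w z j 0 <= c.
Proof. by move=> z0 wc; rewrite -lee_fin usc_envvE//; exact: usc_env_le. Qed.

Lemma usc_envv_lt (z : spacetime) j c : 0 <= z.1 -> usc_envv w z j 0 < c ->
  \forall y \near z, 0 <= y.1 -> w y j 0 <= c.
Proof. by move=> z0 wc; apply: usc_env_lt; rewrite -usc_envvE// lte_fin. Qed.

(** A bound valid near [z] is valid near every point close to [z], hence passes to the envelope
    there. *)
Lemma usc_envv_usc (z : spacetime) j c : 0 <= z.1 -> usc_envv w z j 0 < c ->
  \forall y \near z, 0 <= y.1 -> usc_envv w y j 0 <= c.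
Proof.
move=> z0 /(usc_envv_lt z0) /near_join.
by apply: filterS => y wy y0; exact: usc_envv_le.
Qed.

(** With nonnegative weights the upper limit of the sum is at most the sum of the upper limits. The
    condition [0 < (z - u).1] keeps the shifted points at nonnegative times, where the envelopes
    give bounds. *)
Lemma usc_envv_step (p : 'I_m.+1 -> R) (r : R) (u z : spacetime) i :
  (forall j, 0 <= p j) -> 0 <= z.1 -> 0 < (z - u).1 ->
  (\forall y \near z, 0 <= y.1 -> w y i 0 <= \sum_j p j * w (y - u) j 0 + r) ->
  usc_envv w z i 0 <= \sum_j p j * usc_envv w (z - u) j 0 + r.
Proof.
move=> p0 z0 zu wz; apply/ler_addgt0Pr => e e0.
have S0 : 0 < \sum_j p j + 1 by rewrite ltr_wpDl// sumr_ge0.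
pose d := e / (\sum_j p j + 1).
have d0 : 0 < d by rewrite divr_gt0.
have sub_cvg : y - u @[y --> z] --> z - u.
  exact: (@cvgB R spacetime _ _ _ id (cst u) z u cvg_id (cvg_cst u)).
apply: usc_envv_le => //.
have near_env : \forall y \near z, forall j, w (y - u) j 0 <= usc_envv w (z - u) j 0 + d.
  apply: (@filter_forall _ _ (fun j y => w (y - u) j 0 <= usc_envv w (z - u) j 0 + d) (nbhs z)) => j.
  have zu1 : \forall y \near z, 0 < (y - u).1.
    have : y.1 - u.1 @[y --> z] --> z.1 - u.1.
      by apply: (@cvgB R R^o); [exact: cvg_fst|exact: cvg_cst].
    by move=> /cvgr_gt/(_ 0 zu).
  have envd : usc_envv w (z - u) j 0 < usc_envv w (z - u) j 0 + d by rewrite ltrDl.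
  have := sub_cvg _ (usc_envv_lt (ltW zu) envd).
  by apply: filterS2 zu1 => y yu; apply; exact: ltW.
apply: filterS2 wz near_env => y wy ny y0; apply: le_trans (wy y0) _.
rewrite addrAC lerD2r.
apply: (@le_trans _ _ (\sum_j p j * (usc_envv w (z - u) j 0 + d))).
  by apply: ler_sum => j _; rewrite ler_wpM2l.
under eq_bigr do rewrite mulrDr.
rewrite big_split/= lerD2l -mulr_suml mulrC /d mulrAC ler_pdivrMr//.
by rewrite ler_pM2l// lerDl.
Qed.

End usc_envelope_vector.

(** * Derivatives of test functions along backward lines *)

Section directional_derivative.
Context {R : realType} {N : nat}.
Local Notation spacetime := (R * 'rV[R]_N.+1)%type.

Lemma derive_spacetime (phi : spacetime -> R) (z : spacetime) (a : R) (q : 'rV[R]_N.+1) :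
  differentiable phi z ->
  'D_((a, q) : spacetime) phi z = a * dt phi z + dotv (grad_x phi z) q.
Proof.
move=> dphi; rewrite /dt /dotv deriveE//.
have -> : ((a, q) : spacetime) = a *: ((1, 0) : spacetime) +
    \sum_k q 0 k *: ((0, delta_mx 0 k) : spacetime).
  rewrite {1}(row_sum_delta q).
  have fstS : (\sum_k q 0 k *: ((0, delta_mx 0 k) : spacetime)).1 = 0.
    by rewrite (big_morph fst (id1 := 0) (op1 := +%R))//= big1// => k _; rewrite scaler0.
  have sndS : (\sum_k q 0 k *: ((0, delta_mx 0 k) : spacetime)).2 =
      \sum_k q 0 k *: delta_mx 0 k.
    by rewrite (big_morph snd (id1 := 0) (op1 := +%R)).
  apply: injective_projections => /=.
    by rewrite fstS addr0 [RHS]mulr1.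
  by rewrite sndS [X in _ = X + _]scaler0 add0r.
rewrite linearD linearZ/= linear_sum deriveE//; congr (_ + _).
by apply: eq_bigr => k _; rewrite linearZ/= mxE deriveE// mulrC.
Qed.

Lemma cvg_backward_difference (phi : spacetime -> R) (z : spacetime) (q : 'rV[R]_N.+1) :
  differentiable phi z ->
  h^-1 * (phi (z - ((h, h *: q) : spacetime)) - phi z) @[h --> (0 : R)^'+] -->
  - (dt phi z + dotv (grad_x phi z) q).
Proof.
move=> dphi.
have -> : - (dt phi z + dotv (grad_x phi z) q) = 'D_((- 1, - q) : spacetime) phi z.
  rewrite derive_spacetime// opprD mulN1r; congr (_ + _).
  by rewrite dotvC -dotvNl dotvC.
have dv : derivable phi z ((- 1, - q) : spacetime) by exact: diff_derivable.
have := cvg_dnbhs_at_right dv.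
apply: cvg_trans; apply: near_eq_cvg; near=> h => /=.
congr (_ * (phi _ - _)); rewrite addrC; congr (_ + _).
by apply: injective_projections; [exact: mulrN1|exact: scalerN].
Unshelve. all: by end_near. Qed.

End directional_derivative.

Section viscosity_inequality.
Context {R : realType} {N m : nat}.
Local Notation spacetime := (R * 'rV[R]_N.+1)%type.
Variable w : spacetime -> 'cV[R]_m.+1.
Hypothesis w_bounded : forall (z : spacetime) j, 0 <= z.1 ->
  exists c, \forall y \near z, 0 <= y.1 -> w y j 0 <= c.
Variables (B : 'M[R]_m.+1) (trans : R -> 'M[R]_m.+1) (c : R).
Hypothesis trans_ge0 : forall h i j, 0 < h -> 0 <= trans h i j.
Hypothesis trans_sum1 : forall h i, 0 < h -> \sum_j trans h i j = 1.
Hypothesis trans_first_order : forall h i j, 0 <= h <= 1 ->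
  `|trans h i j - (i == j)%:R + h * B i j| <= c * h ^+ 2.
Local Notation env z j := (usc_envv w z j 0).

Let trans_quotient_cvg i j :
  h^-1 * (trans h i j - (i == j)%:R) @[h --> (0 : R)^'+] --> - B i j.
Proof.
apply/(@cvgrPdist_le R R^o _ ((0 : R)^'+)) => e e0.
have c1 : 0 < `|c| + 1 by rewrite ltr_wpDl.
near=> h.
have h0 : 0 < h by near: h; exact: nbhs_right_gt.
have h1 : h <= 1 by near: h; exact: nbhs_right_le.
have he : h <= e / (`|c| + 1) by near: h; apply: nbhs_right_le; rewrite divr_gt0.
rewrite -normrN opprB opprK.
rewrite (_ : _ + _ = h^-1 * (trans h i j - (i == j)%:R + h * B i j)); last first.
  rewrite [RHS]mulrDr mulKf ?(gt_eqF h0)//.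
rewrite normrM gtr0_norm ?invr_gt0// ler_pdivrMl//.
apply: le_trans (trans_first_order _ _ _) _; first by rewrite (ltW h0).
rewrite expr2 mulrCA ler_pM2l//; move: he; rewrite ler_pdivlMr// => he.
apply: le_trans he; rewrite mulrC ler_wpM2l ?(ltW h0)//.
by rewrite (le_trans (ler_norm c))// lerDl.
Unshelve. all: by end_near. Qed.

(* The local maximum only bounds the [i]-th component along the path; the other
   components are handled by upper semicontinuity, which is enough because the
   transition probabilities are nonnegative. *)
Lemma superdiff_inequality (z : spacetime) i (q : 'rV[R]_N.+1) (l G d : R)
    (p : R * 'rV[R]_N.+1) : 0 < z.1 -> 0 < d ->
  (forall h, 0 < h -> h < d -> \forall y \near z, 0 <= y.1 ->
    w y i 0 <= \sum_j trans h i j * w (y - ((h, h *: q) : spacetime)) j 0 +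
      (h * l + G * h ^+ 2)) ->
  superdiff (fun y => env y i) z p ->
  p.1 + dotv p.2 q + (B *m usc_envv w z) i 0 <= l.
Proof.
move=> z0 d0 dpp [phi [C1phi phi_max ->]] /=.
have dphi : differentiable phi z by have [] := nbhs_singleton C1phi.
(* Along the backward line the components other than [i] are bounded by their envelopes at [z] plus
   [e]. Their total weight is [1 - trans h i i], which is [h * B i i] to first order; division by
   [h] leaves [e * B i i]. *)
suff le_e e : 0 < e ->
    dt phi z + dotv (grad_x phi z) q + (B *m usc_envv w z) i 0 <= l + e * B i i.
  apply/ler_addgt0Pr => e e0.
  have b0 : 0 < `|B i i| + 1 by rewrite ltr_wpDl.
  apply: le_trans (le_e (e / (`|B i i| + 1)) _) _; first by rewrite divr_gt0.
  rewrite lerD2l -mulrA ler_piMr ?(ltW e0)// mulrC ler_pdivrMr// mul1r.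
  by rewrite (le_trans (ler_norm _))// lerDl.
move=> e0.
pose a j h := h^-1 * (trans h i j - (i == j)%:R).
pose psi (h : R) := h^-1 * (phi (z - ((h, h *: q) : spacetime)) - phi z).
(* [h * g h] is the upper bound obtained for [env z i], minus [env z i] itself; so [g] is
   nonnegative for small [h], and the sign of its limit is the required inequality. *)
pose g h := \sum_j a j h * env z j - a i h * e + (1 + h * a i h) * psi h + (l + G * h).
have id0 : (h : R) @[h --> (0 : R)^'+] --> (0 : R) by exact: cvg_at_right_filter.
have g_cvg : g h @[h --> (0 : R)^'+] -->
    \sum_j (- B i j) * env z j - (- B i i) * e +
    (1 + 0 * (- B i i)) * (- (dt phi z + dotv (grad_x phi z) q)) + (l + G * 0).
  have ha j : a j h @[h --> (0 : R)^'+] --> - B i j := @trans_quotient_cvg i j.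
  have hs : \sum_j a j h * env z j @[h --> (0 : R)^'+] --> \sum_j (- B i j) * env z j.
    elim: (index_enum _) => [|j s IH].
      by rewrite big_nil; under eq_fun do rewrite big_nil; exact: cvg_cst.
    rewrite big_cons; under eq_fun do rewrite big_cons.
    by apply: (@cvgD R R^o) => //; apply: (@cvgMr_tmp R); exact: ha.
  apply: (@cvgD R R^o); last first.
    by apply: (@cvgD R R^o); [exact: cvg_cst|apply: (@cvgMl_tmp R)].
  apply: (@cvgD R R^o); last first.
    apply: (@cvgM R); last exact: cvg_backward_difference.
    by apply: (@cvgD R R^o); [exact: cvg_cst|apply: (@cvgM R)].
  by apply: (@cvgB R R^o) => //; apply: (@cvgMr_tmp R); exact: ha.
have path_cvg : z - ((h, h *: q) : spacetime) @[h --> (0 : R)^'+] --> z.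
  have scal h : ((h, h *: q) : spacetime) = h *: ((1, q) : spacetime).
    by apply: injective_projections => //; exact: esym (mulr1 _).
  have : z - h *: ((1, q) : spacetime) @[h --> (0 : R)^'+] --> z - 0 *: ((1, q) : spacetime).
    apply: (@cvgB R spacetime); first exact: cvg_cst.
    by apply: (@cvgZr_tmp R spacetime).
  by rewrite scale0r subr0; under eq_fun do rewrite -scal.
have env_near : \forall y \near z, forall j, 0 <= y.1 -> env y j <= env z j + e.
  apply: (@filter_forall _ _ (fun j (y : spacetime) => 0 <= y.1 -> env y j <= env z j + e) (nbhs z)) => j.
  by apply: usc_envv_usc => //; [exact: ltW|rewrite ltrDl].
have g_ge0 : \forall h \near (0 : R)^'+, 0 <= g h.
  have env_path := path_cvg _ env_near.
  have phi_path := path_cvg _ phi_max.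
  near=> h.
  have h0 : 0 < h by near: h; exact: nbhs_right_gt.
  have hd : h < d by near: h; exact: nbhs_right_lt.
  have hz : h < z.1 by near: h; exact: nbhs_right_lt.
  have envh j : env (z - ((h, h *: q) : spacetime)) j <= env z j + e.
    have : forall j, 0 <= (z - ((h, h *: q) : spacetime)).1 ->
        env (z - ((h, h *: q) : spacetime)) j <= env z j + e.
      by near: h; exact: env_path.
    by apply; rewrite subr_ge0 ltW.
  have phih : env (z - ((h, h *: q) : spacetime)) i - phi (z - ((h, h *: q) : spacetime)) <=
      env z i - phi z.
    by near: h; exact: phi_path.
  have step : env z i <= \sum_j trans h i j * env (z - ((h, h *: q) : spacetime)) j +
      (h * l + G * h ^+ 2).
    apply: usc_envv_step => //; [by move=> j; exact: trans_ge0|exact: ltW|by rewrite subr_gt0|exact: dpp].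
  have transE j : trans h i j = (i == j)%:R + h * a j h.
    by rewrite /a mulVKf ?(gt_eqF h0)// addrC subrK.
  have psiE : phi (z - ((h, h *: q) : spacetime)) = phi z + h * psi h.
    by rewrite /psi mulVKf ?(gt_eqF h0)// [RHS]addrC subrK.
  have sum_le : \sum_j trans h i j * env (z - ((h, h *: q) : spacetime)) j <=
      \sum_j trans h i j * (env z j + e) + trans h i i * (h * psi h - e).
    (* The correction is placed in the term [j = i], where the bound by [phi] replaces the bound
       [env z i + e]. *)
    have -> : trans h i i * (h * psi h - e) =
        \sum_j (if j == i then trans h i j * (h * psi h - e) else 0).
      by rewrite -big_mkcond big_pred1_eq.
    rewrite -big_split/=; apply: ler_sum => j _; case: eqVneq => [->|ji].
      rewrite -mulrDr ler_wpM2l ?trans_ge0//.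
      have -> : env z i + e + (h * psi h - e) = env z i - phi z + (phi z + h * psi h) by ring.
      by rewrite -lerBlDr -psiE.
    by rewrite addr0 ler_wpM2l ?trans_ge0.
  have sumE : \sum_j trans h i j * (env z j + e) = env z i + h * \sum_j a j h * env z j + e.
    under eq_bigr do rewrite mulrDr.
    rewrite big_split/= -mulr_suml trans_sum1// mul1r; congr (_ + _).
    under eq_bigr do rewrite transE mulrDl.
    rewrite big_split/=; congr (_ + _).
      rewrite (bigD1 i)//= eqxx mul1r big1 ?addr0// => j ji.
      by rewrite eq_sym (negbTE ji) mul0r.
    by rewrite mulr_sumr; apply: eq_bigr => j _; rewrite mulrA.
  have : 0 <= h * g h.
    have := le_trans step (lerD sum_le (lexx _)).
    rewrite sumE transE eqxx mulr1n -subr_ge0 => /le_trans; apply.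
    by rewrite le_eqVlt; apply/orP; left; apply/eqP; rewrite /g; ring.
  by rewrite pmulr_rge0.
have FF : ProperFilter ((0 : R)^'+) by exact: at_right_proper_filter.
have := @cvgr_to_ge _ _ FF _ _ _ _ g_cvg g_ge0.
rewrite mul0r addr0 mul1r mulr0 addr0 mxE.
under eq_bigr do rewrite mulNr; rewrite sumrN.
by move=> ?; lra.
Unshelve. all: by end_near. Qed.

End viscosity_inequality.

(** * Viscosity inequality at positive times and bound at the initial time *)

Theorem proposition5p5 (R : realType) (N m : nat)
  (H : 'I_m.+1 -> 'rV[R]_N.+1 -> 'rV[R]_N.+1 -> R)
  (H_unif : forall i, unif_cont_on_balls (H i))
  (H_convex : forall i x, convex_function [set: 'rV[R]_N.+1] (H i x))
  (alpha beta : R -> R)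
  (alpha_super : superlinear alpha) (beta_super : superlinear beta)
  (H_bounds : forall i x p, alpha (enorm p) <= H i x p <= beta (enorm p))
  (B : 'M[R]_m.+1)
  (B_offdiag : forall i j : 'I_m.+1, j != i -> B i j <= 0)
  (B_rows : forall i, \sum_j B i j = 0)
  (P : probability (Omega R m) R)
  (P_markov : markov_chain B P)
  (P_start : forall i : 'I_m.+1, (0 < P (Omega_at i))%E)
  (u0 : 'rV[R]_N.+1 -> 'cV[R]_m.+1)
  (u0_bounded : [bounded u0 x | x in setT])
  (u0_cont : continuous u0) :
  let v := fun z : R * 'rV[R]_N.+1 => lax_oleinik H P z.1 u0 z.2 in
  subsolution H B v /\
  forall (x : 'rV[R]_N.+1) (i : 'I_m.+1),
    (usc_env (fun z => v z i 0%R) (0%R, x) <= (u0 x i 0%R)%:E)%E.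
Proof.
move=> v.
have K_ge0 : 0 <= `|beta 0| by [].
have L_lower i x q : ((- `|beta 0|)%:E <= lagrangian H i x q)%E.
  apply: le_trans (lagrangian_lower_bound H_bounds i x q).
  by rewrite lee_fin lerN2 ler_norm.
have L_bound := lagrangian_upper_bound H_unif H_bounds alpha_super.
have [C0 C0_ge0 L_upper0] := L_bound 0.
have [M M_ge0 u0_bound] : exists2 M, 0 <= M & forall x i, `|u0 x i 0| <= M.
  have [M [_ u0M]] := u0_bounded; exists (`|M| + 1); first by rewrite addr_ge0.
  move=> x i; apply: le_trans (u0M _ _ x I); first exact: coord_le_norm.
  by rewrite (le_lt_trans (ler_norm M))// ltrDl.
have v_le (z : R * 'rV[R]_N.+1) : \forall y \near z, 0 <= y.1 -> forall j,
    v y j 0 <= M + C0 * (z.1 + 1).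
  have : \forall y \near z, y.1 < z.1 + 1.
    by apply: (@cvgr_lt _ _ _ _ _ z.1 cvg_fst); rewrite ltrDl.
  apply: filterS => y yz y0 j.
  apply: le_trans (lax_oleinik_le_bound H_unif K_ge0 L_lower L_upper0 P u0_cont M_ge0 u0_bound y.2 j y0) _.
  by rewrite lerD2l ler_wpM2l// ltW.
have v_bounded (z : R * 'rV[R]_N.+1) j : 0 <= z.1 ->
    exists c, \forall y \near z, 0 <= y.1 -> v y j 0 <= c.
  move=> z0; exists (M + C0 * (z.1 + 1)).
  by apply: filterS (v_le z) => y vy y0; exact: vy.
have [c c_ge0 off_le] := expected_off_time_le P_markov P_start.
have dpp := dynamic_programming_le H_unif K_ge0 L_lower L_upper0 P_markov P_start u0_cont M_ge0 u0_bound.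
have [c1 c1_ge0 trans_first_order] := expmx_first_order B.
split.
  split.
    move=> z z0; exists (M + C0 * (z.1 + 1)).
    have : \forall y \near z, 0 < y.1 by apply: (@cvgr_gt _ _ _ _ _ z.1 cvg_fst).
    by apply: filterS2 (v_le z) => y vy y0; apply: vy; exact: ltW.
  move=> z i p z0 sd.
  apply/ler_addgt0Pr => e e0; rewrite add0r.
  have e2 : 0 < e / 2 by rewrite divr_gt0.
  (* The velocity [q] attains the convex duality at [p.2] up to [e / 2]; the other [e / 2] pays for
     moving the base point of the Lagrangian by less than [d1]. Together they are the [e] in [l]. *)
  have [q Lq] := hamiltonian_le_biconjugate H_unif H_convex i z.2 p.2 e2.
  have [d1 d10 L_near] := lagrangian_usc H_unif H_bounds alpha_super i z.2 q e2.
  pose l := dotv p.2 q - H i z.2 p.2 + e.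
  have L_l x : enorm (x - z.2) < d1 -> (lagrangian H i x q <= l%:E)%E.
    move=> xz; apply: le_trans (L_near x xz) _.
    by apply: le_trans (leeD2r _ Lq) _; rewrite -EFinD lee_fin /l; lra.
  have [Cq Cq_ge0 L_q] := L_bound q.
  (* Since [Cq <= l + C], the bound [Cq] valid in all states takes the form required of [C]; the
     absolute value keeps [C] nonnegative. *)
  pose C := Cq + `|l|.
  have C_ge0 : 0 <= C by rewrite addr_ge0.
  have L_C j x : (lagrangian H j x q <= (l + C)%:E)%E.
    apply: le_trans (L_q j x) _; rewrite lee_fin /C addrCA lerDl.
    by have := ler_norm (- l); rewrite normrN -subr_ge0 opprK addrC.
  have q1 : 0 < 2 * (enorm q + 1) by rewrite mulr_gt0// ltr_wpDl// enorm_ge0.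
  (* [h < 1] serves the off-time estimate, [h < z.1] leaves room for a step back in time, and
     [h |q| < d1 / 2] together with [near_x] keeps the segment within [d1] of [z.2]. *)
  pose d := Num.min 1 (Num.min z.1 (d1 / (2 * (enorm q + 1)))).
  have d0 : 0 < d by rewrite !lt_min ltr01 z0 divr_gt0.
  suff : p.1 + dotv p.2 q + (B *m usc_envv v z) i 0 <= l by rewrite /l => ?; lra.
  apply: (superdiff_inequality v_bounded (trans := fun h => expmx (- h *: B))
    (trans_ge0 P_markov P_start) (trans_sum1 P_markov P_start) trans_first_order z0 d0 _ sd (G := C * c)).
  move=> h h0; rewrite !lt_min => /and3P[h1 hz hd].
  have near_t : \forall y \near z, h < y.1.
    by apply: (@cvgr_gt _ _ _ _ _ z.1 cvg_fst).
  have near_x : \forall y \near z, enorm (y.2 - z.2) < d1 / 2.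
    have d12 : 0 < d1 / 2 by rewrite divr_gt0.
    exact: (cvg_snd (nbhs_enorm z.2 d12)).
  apply: filterS2 near_t near_x => y hy yz y0; rewrite addrA.
  apply: (dpp c h y.1 C l i y.2 q) => //.
  - exact: ltW.
  - by apply: off_le; rewrite !ltW.
  - move=> s /andP[s0 sh]; apply: L_l.
    rewrite addrAC; apply: le_lt_trans (enorm_triangle _ _) _.
    rewrite enormN enormZ ger0_norm// [ltRHS]splitr; apply: ltr_leD => //.
    apply: (@le_trans _ _ (h * (enorm q + 1))).
      by rewrite ler_pM ?enorm_ge0// lerDl.
    by move: hd; rewrite invfM mulrA ltr_pdivlMr ?ltr_wpDl ?enorm_ge0//; exact: ltW.
move=> x i.
(* [C0] is the cost rate of staying at rest; the sum bounds, per unit of time, the effect of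
   replacing row [i] of the transition matrix by that of the identity on data bounded by [M]. *)
pose A := C0 + \sum_j (c1 + `|B i j|) * M.
have A0 : 0 <= A.
  by rewrite addr_ge0// sumr_ge0// => j _; rewrite mulr_ge0// addr_ge0.
have v0_le y j := lax_oleinik0_le H_unif K_ge0 L_lower L_upper0 P_start u0_cont M_ge0 u0_bound y j.
have v_le_u0 t y : 0 <= t <= 1 -> v (t, y) i 0 <= u0 y i 0 + A * t.
  move=> /andP[t0 t1]; move: t0; rewrite le_eqVlt => /orP[/eqP <-|t0].
    by rewrite mulr0 addr0; exact: v0_le.
  have t01 : 0 <= t <= 1 by rewrite (ltW t0).
  (* One step of length [t] at zero velocity, with [l = C0] and [C = 0]: the bound [C0] at rest
     holds in every state, so leaving [i] adds no cost. *)
  have := dpp c t t 0 C0 i y 0 t0 (lexx t) (off_le t i t01) (lexx 0).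
  rewrite subrr scaler0 subr0 !mul0r addr0 addr0 => /(_ _ _)/le_trans; apply.
  - by move=> s _; exact: L_upper0.
  - by move=> j s; exact: L_upper0.
  rewrite /A mulrDl addrA (mulrC t) addrAC lerD2r.
  apply: (@le_trans _ _ (\sum_j ((i == j)%:R * u0 y j 0 + (c1 + `|B i j|) * M * t))).
    apply: ler_sum => j _.
    apply: (@le_trans _ _ (expmx (- t *: B) i j * u0 y j 0)).
      by rewrite ler_wpM2l ?(trans_ge0 P_markov P_start)//; exact: v0_le.
    rewrite -lerBlDl -mulrBl; apply: le_trans (ler_norm _) _.
    rewrite normrM mulrAC ler_pM//.
    have := trans_first_order t i j t01.
    set r := expmx _ i j - _ => hr.
    have -> : r = (r + t * B i j) - t * B i j by rewrite addrK.
    apply: le_trans (ler_normB _ _) _; rewrite mulrDl; apply: lerD.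
      apply: le_trans hr _; rewrite ler_wpM2l// expr2 -[leRHS]mul1r.
      by rewrite ler_wpM2r// ltW.
    by rewrite normrM mulrC (gtr0_norm t0).
  rewrite big_split/= -mulr_suml lerD2r (bigD1 i)//= eqxx mul1r big1 ?addr0// => j ji.
  by rewrite eq_sym (negbTE ji) mul0r.
apply/lee_addgt0Pr => e e0; rewrite -EFinD.
have e2 : 0 < e / 2 by rewrite divr_gt0.
have Ae : 0 < e / 2 / (A + 1) by rewrite divr_gt0// ltr_wpDl.
apply: usc_env_le.
have near_1 : \forall y \near ((0 : R), x), y.1 < 1.
  by apply: (@cvgr_lt _ _ _ _ _ (0 : R) cvg_fst).
have near_t : \forall y \near ((0 : R), x), y.1 < e / 2 / (A + 1).
  by apply: (@cvgr_lt _ _ _ _ _ (0 : R) cvg_fst).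
have near_u0 : \forall y \near ((0 : R), x), u0 y.2 i 0 < u0 x i 0 + e / 2.
  have u0_i : u0 y i 0 @[y --> x] --> u0 x i 0.
    apply: (@continuous_comp _ _ _ u0 (fun v => v i 0)); first exact: u0_cont.
    exact: coord_continuous.
  have : \forall y \near x, u0 y i 0 < u0 x i 0 + e / 2.
    by apply: (cvgr_lt _ u0_i); rewrite ltrDl.
  by move=> u0_near; exact: (cvg_snd u0_near).
apply: filterS3 near_1 near_t near_u0 => -[t y] /= t1 tA yx t0.
apply: le_trans (v_le_u0 t y _) _; first by rewrite t0 ltW.
rewrite [e]splitr addrA; apply: lerD; first exact: ltW.
move: tA; rewrite ltr_pdivlMr ?ltr_wpDl// => /ltW; apply: le_trans.
by rewrite mulrC ler_wpM2l// lerDl.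
Qed.
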